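(* There exists an algorithm that solves the black-and-white coloring problem on interval graphs in $O(n^6)$ time; that is, given an interval graph $G$ with $n$ vertices and integers $b$ and $w$, the algorithm decides in $O(n^6)$ time whether $G$ has a black-and-white coloring with $b$ black vertices and $w$ white vertices.
   Context: Graphs are finite, simple and undirected. A black-and-white coloring of a graph $G=(V,E)$ with $b$ black and $w$ white vertices is a pair of disjoint sets $B,W\subseteq V$ (the black and the white vertices) with $|B|=b$ and $|W|=w$ such that no vertex of $B$ is adjacent to any vertex of $W$; the vertices outside $B\cup W$ are uncolored. The black-and-white coloring problem takes as input a graph $G$ and integers $b$ and $w$ and asks whether such a coloring exists. A graph is an interval graph if it is the intersection graph of a collection of intervals on the real line. Running time is measured in the usual RAM model. *)

(* Defs.v *)
From mathcomp Require Import all_boot all_order all_algebra.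
From mathcomp Require Import all_classical all_reals.

Set Implicit Arguments.
Unset Strict Implicit.
Unset Printing Implicit Defensive.

Record sgraph (V : finType) := SGraph {
  adj :> rel V;
  adj_sym : symmetric adj;
  adj_irrefl : irreflexive adj
}.

(* [interval R] comprises all intervals of the real line: open, closed or
   half-open, bounded or not. *)
Definition interval_graph (R : realType) (V : finType) (G : sgraph V) : Prop :=
  exists I : V -> interval R,
    forall u v, u != v ->
      (adj G u v <-> ([set` I u] `&` [set` I v] !=set0)%classic).

Definition bw_colorable (V : finType) (G : sgraph V) (b w : nat) : Prop :=
  exists B W : {set V},
    [/\ [disjoint B & W], #|B| = b, #|W| = w &
        forall x y, x \in B -> y \in W -> ~~ adj G x y].

(* A random access machine: a fixed program, registers r_0, r_1, ... named in
   the instructions, and a memory m accessed through addresses held in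
   registers.  Every instruction costs one step. *)
Inductive instr :=
| Const of nat & nat          (* Const d c   : r_d := c *)
| Move of nat & nat           (* Move d i    : r_d := r_i *)
| Plus of nat & nat & nat     (* Plus d i j  : r_d := r_i + r_j *)
| Minus of nat & nat & nat    (* Minus d i j : r_d := r_i - r_j, truncated *)
| Times of nat & nat & nat    (* Times d i j : r_d := r_i * r_j *)
| Quot of nat & nat & nat     (* Quot d i j  : r_d := r_i %/ r_j *)
| Read of nat & nat           (* Read d i    : r_d := m[r_i] *)
| Write of nat & nat          (* Write i j   : m[r_i] := r_j *)
| Jump of nat                 (* Jump l      : goto l *)
| JumpEq of nat & nat & nat   (* JumpEq i j l: if r_i = r_j goto l *)
| JumpLt of nat & nat & nat   (* JumpLt i j l: if r_i < r_j goto l *)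
| Halt of bool.               (* stop and answer yes (true) or no (false) *)

Definition program := seq instr.

Inductive config :=
| Running (pc : nat) (r m : nat -> nat)
| Halted (answer : bool)
| Crashed.

Definition upd (f : nat -> nat) (i v : nat) : nat -> nat :=
  fun j => if j == i then v else f j.

(* Machine words hold the naturals below [M]: computing any other value crashes
   the machine, so that a halting run never uses one.  Leaving the program
   without [Halt] crashes as well. *)
Definition step (M : nat) (P : program) (c : config) : config :=
  if c is Running pc r m then
    let set d v :=
      if v < M then Running pc.+1 (upd r d v) m else Crashed in
    match onth P pc with
    | None => Crashed
    | Some (Const d a) => set d a
    | Some (Move d i) => set d (r i)
    | Some (Plus d i j) => set d (r i + r j)
    | Some (Minus d i j) => set d (r i - r j)
    | Some (Times d i j) => set d (r i * r j)
    | Some (Quot d i j) => set d (r i %/ r j)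
    | Some (Read d i) => set d (m (r i))
    | Some (Write i j) => Running pc.+1 r (upd m (r i) (r j))
    | Some (Jump l) => Running l r m
    | Some (JumpEq i j l) => Running (if r i == r j then l else pc.+1) r m
    | Some (JumpLt i j l) => Running (if r i < r j then l else pc.+1) r m
    | Some (Halt a) => Halted a
    end
  else c.

Definition run (M : nat) (P : program) (t : nat) (c : config) : config :=
  iter t (step M P) c.

(* The input: n, b, w in registers 0, 1, 2, the row-major adjacency matrix in
   memory cells 0, ..., n * n - 1, and zeros everywhere else. *)
Definition adj_cell (n : nat) (G : sgraph 'I_n) (a : nat) : nat :=
  match insub (a %/ n), insub (a %% n) with
  | Some u, Some v => adj G u v
  | _, _ => 0
  end.

Definition bw_input (n : nat) (G : sgraph 'I_n) (b w : nat) : config :=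
  Running 0 (nth 0 [:: n; b; w]) (adj_cell G).

(* Words of k * log2 (n + b + w + 2) bits, i.e. logarithmic in the numbers that
   make up the input. *)
Definition word_bound (k n b w : nat) : nat := (n + b + w + 2) ^ k.

Definition bigO (f g : nat -> nat) : Prop :=
  exists c n0, forall n, n0 <= n -> f n <= c * g n.

(* Main.v *)
(** For distinct nonadjacent u, v, transitive orientations of the complement of
    an interval graph obey forcings: a -> b and a -> c go together when b, c are
    adjacent or equal.  Transitively closing the forcing relation with
    Warshall's algorithm on the n^2 ordered pairs costs O(n^6).  Directing every
    forcing class by its lexicographically first increasing pair gives a
    transitive orientation (Hell and Huang), by Golumbic's triangle lemma.
    Since an interval graph has no induced C4, successor sets are nested, and
    ordering the vertices by decreasing successor sets yields a linear order in
    which u < c < v and c, v nonadjacent imply u, v nonadjacent.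

    Along this order a coloring is checked by comparing each black vertex with
    the last white one before it only, and vice versa.  So n + 1 rounds of
    relaxation over the states (last black, last white, number of blacks,
    number of whites) and the next vertex suffice, again O(n^6) steps. *)
Require Import Defs.
From mathcomp Require Import all_boot all_order all_algebra.
From mathcomp Require Import all_classical all_reals.
From mathcomp Require Import zify.

Set Implicit Arguments.
Unset Strict Implicit.
Unset Printing Implicit Defensive.

(** * Loop programs over relations and their compilation *)

(** The machine sees only the adjacency matrix, so the algorithm cannot consult an interval model. A
    model enters the correctness proof through two facts alone: no forcing class contains an arc
    together with its reversal, and the nonadjacency relation [h] contains no two disjoint edges
    without a third edge between them. The orientation obtained need not be the left-to-right order
    of any particular model. Directing the forcing classes independently could produce cyclic
    triangles; the lexicographic rule is what excludes them without recomputing classes after each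
    choice.

    The other obstacle is that the time bound concerns a concrete machine with bounded words. Hence
    the small loop language: its relations only grow, which separates soundness (an invariant) from
    completeness (facts that persist), and its running time is governed by the nesting depth of
    loops. Depth 6 is attained twice, by the closure (one pair as pivot, two pairs to be linked) and
    by the dynamic program (a round, a vertex, four components of a state). *)

(* A program is built from loops over 0, ..., n that test and enlarge boolean
   relations; a tuple ds of the relation numbered t is the key t :: ds. *)
Inductive cond :=
| Lt of nat & nat
| Neq of nat & nat
| Adj of nat & nat
| In of nat & seq nat.

Inductive cmd :=
| Put of nat & seq nat
| If of bool & cond & cmd
| Seq of cmd & cmd
| For of cmd
| Pred of nat & cmd.

Definition key (rho : seq nat) (tag : nat) (args : seq nat) : seq nat :=
  tag :: map (nth 0 rho) args.

Definition rels := seq nat -> bool.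

Section Semantics.
Variables (n : nat) (cell : nat -> nat).

Definition test (rho : seq nat) (X : rels) (c : cond) : bool :=
  match c with
  | Lt i j => nth 0 rho i < nth 0 rho j
  | Neq i j => nth 0 rho i != nth 0 rho j
  | Adj i j => cell (nth 0 rho i * n + nth 0 rho j) != 0
  | In t args => X (key rho t args)
  end.

Fixpoint sem (c : cmd) (rho : seq nat) (X : rels) : rels :=
  match c with
  | Put t args => fun k => (k == key rho t args) || X k
  | If p c e => if test rho X c == p then sem e rho X else X
  | Seq e f => sem f rho (sem e rho X)
  | For e => foldl (fun Y i => sem e (rcons rho i) Y) X (iota 0 n.+1)
  | Pred i e => sem e (rcons rho (nth 0 rho i).-1) X
  end.

End Semantics.

(* Registers 0-5 hold n, b, w, 0, 1, n + 1; the variable bound at depth d lives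
   in register d, and the registers from d on serve as scratch space. *)
Definition addr_code (d t : nat) (args : seq nat) : seq instr :=
  Const d t :: flatten [seq [:: Times d d 5; Plus d d a] | a <- args] ++
  [:: Times d.+1 5 5; Plus d d d.+1].

(** Register [d] ends up nonzero exactly when the condition holds. As subtraction is truncated,
    [j - i] serves for [Lt], and the sum of both differences for [Neq]. *)
Definition cond_code (d : nat) (c : cond) : seq instr :=
  match c with
  | Lt i j => [:: Minus d j i]
  | Neq i j => [:: Minus d i j; Minus d.+1 j i; Plus d d d.+1]
  | Adj i j => [:: Times d i 0; Plus d d j; Read d d]
  | In t args => addr_code d t args ++ [:: Read d d]
  end.

Fixpoint compile (d pc : nat) (c : cmd) : seq instr :=
  match c with
  | Put t args => addr_code d t args ++ [:: Write d 4]
  | If p c e =>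
      let s := cond_code d c in
      let s' := compile d (pc + size s).+1 e in
      let l := (pc + size s).+1 + size s' in
      s ++ (if p then JumpEq d 3 l else JumpLt 3 d l) :: s'
  | Seq e f =>
      let s := compile d pc e in s ++ compile d (pc + size s) f
  | For e =>
      let s := compile d.+1 pc.+2 e in
      Const d 0 :: JumpEq d 5 (pc.+2 + size s).+2 ::
      s ++ [:: Plus d d 4; Jump pc.+1]
  | Pred i e => Minus d i 4 :: compile d.+1 pc.+1 e
  end.

(* The registers 1, 2, 4 and 5 may hold values above n (register 4 does when
   n = 0), so they cannot supply components of a key. *)
Definition small (d i : nat) : bool := (i < d) && (i \notin [:: 1; 2; 4; 5]).

Definition wf_args (d t : nat) (args : seq nat) : bool :=
  [&& t < 8, size args == 4 & all (small d) args].

Definition wf_cond (d : nat) (c : cond) : bool :=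
  match c with
  | Lt i j | Neq i j => (i < d) && (j < d)
  | Adj i j => small d i && small d j
  | In t args => wf_args d t args
  end.

Fixpoint wf (d : nat) (c : cmd) : bool :=
  match c with
  | Put t args => wf_args d t args
  | If _ c e => wf_cond d c && wf d e
  | Seq e f => wf d e && wf d f
  | For e => wf d.+1 e
  | Pred i e => small d i && wf d.+1 e
  end.

(** An address takes 1 + 2 * 4 + 2 = 11 instructions; [Put] adds the write, [If] a read and a jump.
    A loop costs an initialization and a final exit test, and three instructions of control per
    iteration. *)
Fixpoint cost (N : nat) (c : cmd) : nat :=
  match c with
  | Put _ _ => 12
  | If _ _ e => 13 + cost N e
  | Seq e f => cost N e + cost N f
  | For e => 2 + N * (3 + cost N e)
  | Pred _ e => 1 + cost N e
  end.

Fixpoint depth (c : cmd) : nat :=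
  match c with
  | Put _ _ => 0
  | If _ _ e | Pred _ e => depth e
  | Seq e f => maxn (depth e) (depth f)
  | For e => (depth e).+1
  end.

(** The 5 for a loop comes from 2 + 3 * N <= 5 * N when N is positive. *)
Fixpoint weight (c : cmd) : nat :=
  match c with
  | Put _ _ => 12
  | If _ _ e => 13 + weight e
  | Seq e f => weight e + weight f
  | For e => 5 + weight e
  | Pred _ e => 1 + weight e
  end.

Lemma cost_le N c : 0 < N -> cost N c <= weight c * N ^ depth c.
Proof.
move=> N0; elim: c => [t args|p c e IH|e IHe f IHf|e IH|i e IH] /=.
- by rewrite expn0.
- have : 0 < N ^ depth e by rewrite expn_gt0 N0.
  rewrite mulnDl; lia.
- rewrite mulnDl; apply: leq_add.
    by apply: leq_trans IHe _; rewrite leq_mul2l leq_pexp2l ?orbT // leq_maxl.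
  by apply: leq_trans IHf _; rewrite leq_mul2l leq_pexp2l ?orbT // leq_maxr.
- have h0 : 0 < N ^ depth e by rewrite expn_gt0 N0.
  rewrite expnS; nia.
- have : 0 < N ^ depth e by rewrite expn_gt0 N0.
  rewrite mulnDl; lia.
Qed.

(** * Correctness and running time of the compiled code *)

Definition code_at (P : program) (pc : nat) (s : seq instr) : Prop :=
  exists A B, P = A ++ s ++ B /\ size A = pc.

Lemma code_at_cat P pc s s' :
  code_at P pc (s ++ s') -> code_at P pc s /\ code_at P (pc + size s) s'.
Proof.
case=> A [B [-> <-]]; split; first by exists A, (s' ++ B); rewrite !catA.
by exists (A ++ s), B; rewrite !catA size_cat.
Qed.

Lemma code_at_cons P pc i s :
  code_at P pc (i :: s) -> onth P pc = Some i /\ code_at P pc.+1 s.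
Proof.
case=> A [B [-> <-]]; split.
  by rewrite onth_cat ltnn subnn.
by exists (rcons A i), B; rewrite cat_rcons size_rcons.
Qed.

Local Arguments onth : simpl never.
Local Arguments addr_code : simpl never.

Section Compile.
Variables (M : nat) (P : program).

Definition runs (t : nat) (c c' : config) : Prop :=
  exists2 s, s <= t & run M P s c = c'.

Lemma runs0 c t : runs t c c.
Proof. by exists 0. Qed.

Lemma runs_trans t t' c1 c2 c3 :
  runs t c1 c2 -> runs t' c2 c3 -> runs (t + t') c1 c3.
Proof.
move=> [s st <-] [s' st' <-]; exists (s' + s); first by lia.
by rewrite /run iterD.
Qed.

Lemma runsS t c1 c2 : runs t (step M P c1) c2 -> runs t.+1 c1 c2.
Proof. by case=> s st <-; exists s.+1 => //; rewrite /run iterSr. Qed.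

Lemma upd_eq f i v : upd f i v i = v.
Proof. by rewrite /upd eqxx. Qed.

Lemma upd_lt f d i v : i < d -> upd f d v i = f i.
Proof. by rewrite /upd; case: eqP => // ->; rewrite ltnn. Qed.

Variables (n b w : nat) (cell : nat -> nat).

Definition base : seq nat := [:: n; b; w; 0; 1; n.+1].
Notation B := (n + b + w + 2).
(** Addresses are the largest numbers computed. Since [B] is at least 2, a tag accounts for a factor
    8 <= B ^ 3 and four digits for (n + 1) ^ 4 <= B ^ 4; with the offset (n + 1) ^ 2 this stays
    below B ^ 7 + B ^ 2 <= B ^ 8. *)
Definition wide_enough : Prop := B ^ 8 <= M.
Hypothesis MB : wide_enough.

Definition horner (a : nat) (ds : seq nat) : nat :=
  foldl (fun a x => a * n.+1 + x) a ds.

(** The offset skips every cell [i * n + j] with i, j <= n, so that writing a relation never damages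
    the matrix. *)
Definition addr (k : seq nat) : nat := horner 0 k + n.+1 * n.+1.

Lemma horner_lt a ds : all (leq^~ n) ds -> horner a ds < a.+1 * n.+1 ^ size ds.
Proof.
elim: ds a => [|x ds IH] a /=; first by rewrite expn0 muln1.
move=> /andP[xn ad]; apply: leq_trans (IH _ ad) _.
rewrite expnS mulnA leq_mul2r; apply/orP; right; nia.
Qed.

Lemma horner_inj a a' ds ds' : size ds = size ds' ->
  all (leq^~ n) ds -> all (leq^~ n) ds' ->
  horner a ds = horner a' ds' -> a = a' /\ ds = ds'.
Proof.
elim: ds ds' a a' => [|x ds IH] [|x' ds'] a a' //= [ss] /andP[xn ad].
move=> /andP[xn' ad'] e; have [e1 ->] := IH _ _ _ ss ad ad' e.
have e2 : x = x' by have := congr1 (modn^~ n.+1) e1;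
  rewrite /= !modnMDl !modn_small.
split; last by rewrite e2.
by move: e1; rewrite e2 => /addIn/eqP; rewrite eqn_pmul2r // => /eqP.
Qed.

Definition good (rho : seq nat) : Prop :=
  exists2 vs, rho = base ++ vs & all (leq^~ n) vs.

Definition agree (rho : seq nat) (r : nat -> nat) : Prop :=
  forall i, i < size rho -> r i = nth 0 rho i.

Lemma small_le rho i : good rho -> small (size rho) i -> nth 0 rho i <= n.
Proof.
case=> vs -> /allP avs /andP[]; rewrite size_cat !inE nth_cat.
have [hi|hi lt _] := ltnP i (size base).
  by move: hi => + _; case: i => [|[|[|[|[|[|i]]]]]] //=.
by apply/avs/mem_nth; move: hi lt => /=; lia.
Qed.

Lemma good_lt rho i : good rho -> nth 0 rho i < B.
Proof.
case=> vs -> /allP avs; rewrite nth_cat; have [hi|hi] := ltnP i (size base).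
  by move: hi; case: i => [|[|[|[|[|[|i]]]]]] //= _; lia.
have [lt|ge] := ltnP (i - size base) (size vs).
  by apply: leq_ltn_trans (avs _ (mem_nth 0 lt)) _; lia.
by rewrite nth_default //; lia.
Qed.

Lemma base_nth rho i : good rho -> i < 6 -> nth 0 rho i = nth 0 base i.
Proof. by case=> vs -> _ i6; rewrite nth_cat i6. Qed.

Lemma good_size rho : good rho -> 6 <= size rho.
Proof. by case=> vs -> _; rewrite size_cat. Qed.

Lemma agree_base rho r i :
  good rho -> agree rho r -> i < 6 -> r i = nth 0 base i.
Proof.
move=> g a i6; rewrite -(base_nth g i6) a //.
by apply: leq_trans i6 (good_size g).
Qed.

Lemma good_rcons rho x : good rho -> x <= n -> good (rcons rho x).
Proof.
case=> vs -> av xn; exists (rcons vs x); first by rewrite rcons_cat.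
by rewrite all_rcons xn.
Qed.

Lemma agree_upd rho r x v : size rho <= x -> agree rho r -> agree rho (upd r x v).
Proof.
by move=> sx a i hi; rewrite upd_lt ?a //; apply: leq_trans sx.
Qed.

Lemma agree_rcons rho r x :
  agree rho r -> agree (rcons rho x) (upd r (size rho) x).
Proof.
move=> a i; rewrite size_rcons ltnS leq_eqVlt nth_rcons => /orP[/eqP->|hi].
  by rewrite upd_eq ltnn eqxx.
by rewrite hi upd_lt // a.
Qed.

Lemma agree_belast rho r x : agree (rcons rho x) r -> agree rho r.
Proof.
move=> a i hi; rewrite a ?size_rcons; last exact: ltnW.
by rewrite nth_rcons hi.
Qed.

Lemma B_lt e x : e <= 8 -> x < B ^ e -> x < M.
Proof.
move=> e8 xe; apply: leq_trans MB; apply: leq_trans xe _.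
by apply: leq_pexp2l => //; lia.
Qed.

Lemma B8 : 8 <= B ^ 3.
Proof. by rewrite (_ : 8 = 2 ^ 3) // leq_exp2r //; lia. Qed.

Lemma nB2 : n.+1 ^ 2 <= B ^ 2.
Proof. by rewrite leq_exp2r //; lia. Qed.

Lemma B23 : B ^ 2 < B ^ 3.
Proof. by rewrite ltn_exp2l //; lia. Qed.

Lemma B728 : B ^ 7 + B ^ 2 <= B ^ 8.
Proof.
rewrite (expnS _ 7); apply: (@leq_trans (2 * B ^ 7)).
  by rewrite mul2n -addnn leq_add2l leq_exp2l //; lia.
by rewrite leq_mul2r; apply/orP; right; lia.
Qed.

Lemma horner_lt_M rho t args :
  good rho -> t < 8 -> size args <= 4 -> all (small (size rho)) args ->
  horner t (map (nth 0 rho) args) < B ^ 7.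
Proof.
move=> g t8 s4 sm.
have ha : all (leq^~ n) (map (nth 0 rho) args).
  rewrite all_map; apply/allP => i ii /=.
  by apply: small_le => //; apply: (allP sm).
apply: leq_trans (horner_lt t ha) _.
rewrite size_map (_ : 7 = 3 + 4) // expnD; apply: leq_mul.
  by apply: leq_trans B8; lia.
apply: (@leq_trans (n.+1 ^ 4)); first by rewrite leq_pexp2l.
by rewrite leq_exp2r //; lia.
Qed.

Lemma horner_code_runs rho r m pc a args s :
  good rho -> agree rho r -> a < 8 -> size s + size args <= 4 ->
  all (small (size rho)) s -> all (small (size rho)) args ->
  let d := size rho in
  let cs := flatten [seq [:: Times d d 5; Plus d d a] | a <- args] in
  r d = horner a (map (nth 0 rho) s) ->
  code_at P pc cs ->
  exists r', [/\ agree rho r',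
    r' d = horner a (map (nth 0 rho) (s ++ args)) &
    runs (2 * size args) (Running pc r m) (Running (pc + size cs) r' m)].
Proof.
move=> g ag a8; elim: args s r pc ag => [|x args IH] s r pc ag ss sms sma d cs rd.
  by exists r; rewrite cats0 addn0; split => //; apply: runs0.
rewrite /cs /= -/d => /code_at_cons [e1 /code_at_cons[e2 ca]].
move/andP: sma => [smx sma].
have d5 : r 5 = n.+1 by rewrite (agree_base g ag).
have [xd xn] : x < d /\ r x <= n.
  by split; [case/andP: smx | rewrite ag ?small_le //; case/andP: smx].
have H : horner a (map (nth 0 rho) (rcons s x)) < B ^ 7.
  apply: horner_lt_M => //; rewrite ?size_rcons ?all_rcons ?smx //.
  by move: ss => /=; lia.
have E : horner a (map (nth 0 rho) (rcons s x)) = r d * r 5 + r x.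
  by rewrite map_rcons /horner foldl_rcons -/(horner _ _) rd d5 ag.
pose r1 := upd r d (r d * r 5); pose r2 := upd r1 d (r1 d + r1 x).
have r2d : r2 d = horner a (map (nth 0 rho) (rcons s x)).
  by rewrite /r2 /r1 !upd_eq upd_lt // E.
have [|||r' [ag' r'd ru]] := IH (rcons s x) r2 pc.+2 _ _ _ sma r2d ca.
- by do 2!apply: agree_upd => //.
- by rewrite size_rcons; move: ss => /=; lia.
- by rewrite all_rcons smx.
exists r'; rewrite -cat_rcons; split=> //.
rewrite (_ : 2 * size (x :: args) = (2 * size args).+2); last by rewrite /=; lia.
apply/runsS; rewrite /= e1 ifT; last first.
  by apply: (@B_lt 7) => //; apply: leq_ltn_trans H; rewrite E leq_addr.
apply/runsS; rewrite /= e2 -/r1 ifT.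
  by rewrite -/r2 -!addSnnS; exact: ru.
by rewrite /r1 upd_eq upd_lt // -E; apply: (@B_lt 7).
Qed.

Lemma addr_code_runs rho r m pc t args :
  good rho -> agree rho r -> wf_args (size rho) t args ->
  let d := size rho in
  let cs := addr_code d t args in
  code_at P pc cs ->
  exists r', [/\ agree rho r', r' d = addr (key rho t args) &
    runs 11 (Running pc r m) (Running (pc + size cs) r' m)].
Proof.
move=> g ag /and3P[t8 /eqP s4 sma] d cs.
rewrite /cs /addr_code => /code_at_cons [e1 /code_at_cat [ca1 ca2]].
pose r1 := upd r d t.
have ag1 : agree rho r1 by apply: agree_upd.
have := @horner_code_runs rho r1 m pc.+1 t args [::] g ag1 t8.
rewrite s4 => /(_ isT isT sma); rewrite -/d.
case; [by rewrite /r1 upd_eq | by [] | move=> r2 [ag2 r2d ru]].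
move: ca2 => /code_at_cons [e2 /code_at_cons[e3 _]].
set pc' := _ + _ in e2 e3 ru.
have d5 : r2 5 = n.+1 by rewrite (agree_base g ag2).
pose r3 := upd r2 d.+1 (r2 5 * r2 5).
pose r4 := upd r3 d (r3 d + r3 d.+1).
have r3d : r3 d = r2 d by rewrite /r3 upd_lt.
have H : r2 d < B ^ 7 by rewrite r2d; apply: horner_lt_M; rewrite ?s4.
have sq : n.+1 * n.+1 = n.+1 ^ 2 by rewrite expnS expn1.
exists r4; split.
- by do 2!apply: agree_upd => //.
- by rewrite /r4 upd_eq r3d /r3 upd_eq /addr /= mul0n d5 r2d.
- rewrite (_ : 11 = (2 * 4 + 2).+1) //; apply/runsS; rewrite /= e1 ifT.
    apply: (runs_trans ru).
    apply/runsS; rewrite /= e2 ifT; last first.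
      by apply: (@B_lt 3) => //; apply: leq_ltn_trans B23; rewrite d5 sq nB2.
    apply/runsS; rewrite /= e3 ifT -/r3.
      rewrite -/r4 (_ : pc + _ = pc'.+2); first exact: runs0.
      by rewrite /pc' /= size_cat /=; lia.
    rewrite r3d /r3 upd_eq d5 sq; apply: (@B_lt 8) => //.
    by apply: leq_trans B728; rewrite -addSn; apply: leq_add nB2.
  apply: (@B_lt 3) => //; apply: leq_trans B8 => //.
Qed.

(** The first clause makes every value read fit into a word; the second extends to all cells that
    [Adj] can address with indices up to [n]. *)
Definition represents (m : nat -> nat) (X : rels) : Prop :=
  [/\ forall a, m a <= 1,
      forall a, a < n.+1 * n.+1 -> m a = cell a &
      forall t ds, size ds = 4 -> all (leq^~ n) ds ->
        (m (addr (t :: ds)) != 0) = X (t :: ds)].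

Lemma key_small rho t args : good rho -> wf_args (size rho) t args ->
  size (map (nth 0 rho) args) = 4 /\ all (leq^~ n) (map (nth 0 rho) args).
Proof.
move=> g /and3P[_ /eqP s4 sm]; split; first by rewrite size_map.
rewrite all_map; apply/allP => i ii /=.
by apply: small_le => //; apply: (allP sm).
Qed.

Lemma represents_put rho m X t args :
  good rho -> wf_args (size rho) t args -> represents m X ->
  represents (upd m (addr (key rho t args)) 1)
    (sem n cell (Put t args) rho X).
Proof.
move=> g wfa [m1 mc mX]; have [s4 a4] := key_small g wfa.
split=> [a|a ha|t' ds sd ad]; first by rewrite /upd; case: ifP.
  by rewrite upd_lt ?mc // /addr; apply: leq_trans ha (leq_addl _ _).
rewrite /upd /=; have [->|ne] := eqVneq (t' :: ds) (key rho t args).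
  by rewrite eqxx.
rewrite ifF ?mX //; apply/negbTE; apply: contra ne => /eqP /addIn.
rewrite /key /horner /= !mul0n !add0n.
by case/horner_inj => [|//|//|-> ->]; first by rewrite sd s4.
Qed.

Lemma cond_code_runs rho r m X pc c :
  good rho -> agree rho r -> represents m X -> wf_cond (size rho) c ->
  let d := size rho in
  let cs := cond_code d c in
  code_at P pc cs ->
  exists r', [/\ agree rho r', (r' d != 0) = test n cell rho X c &
    runs 12 (Running pc r m) (Running (pc + size cs) r' m)].
Proof.
move=> g ag mX wc d cs; rewrite /cs.
have ltM i : nth 0 rho i < M by apply: (@B_lt 1) => //; rewrite expn1 good_lt.
case: c wc {cs} => [i j|i j|i j|t args] wc.
- move=> /= /code_at_cons [e1 _]; case/andP: wc => iD jD.
  exists (upd r d (r j - r i)); split; first exact: agree_upd.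
    by rewrite upd_eq !ag //; lia.
  apply/runsS; rewrite /= e1 ifT ?addn1; first exact: runs0.
  by rewrite ag //; have := ltM j; lia.
- move=> /= /code_at_cons [e1 /code_at_cons [e2 /code_at_cons [e3 _]]].
  case/andP: wc => iD jD.
  have li := ltM i; have lj := ltM j.
  pose r1 := upd r d (r i - r j); pose r2 := upd r1 d.+1 (r1 j - r1 i).
  pose r3 := upd r2 d (r2 d + r2 d.+1).
  have E : r2 d + r2 d.+1 = (r i - r j) + (r j - r i).
    by rewrite {2}/r2 upd_eq /r2 upd_lt // /r1 upd_eq !upd_lt.
  have := ag _ iD; have := ag _ jD => ej ei.
  exists r3; split; first by do 3!apply: agree_upd => //.
    by rewrite /r3 upd_eq E; lia.
  apply/runsS; rewrite /= e1 ifT; last by lia.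
  apply/runsS; rewrite /= e2 ifT -/r1; last by rewrite /r1 !upd_lt //; lia.
  apply/runsS; rewrite /= e3 ifT -/r2; last by rewrite E; lia.
  by rewrite -/r3 !addnS addn0; apply: runs0.
- move=> /= /code_at_cons [e1 /code_at_cons [e2 /code_at_cons [e3 _]]].
  have [m1 mc _] := mX; case/andP: wc => si sj.
  have [iD jD] : i < d /\ j < d by case/andP: si; case/andP: sj.
  have := small_le g si; have := small_le g sj; rewrite -!ag // => jn i_n.
  have r0 : r 0 = n by rewrite (agree_base g ag).
  pose r1 := upd r d (r i * r 0); pose r2 := upd r1 d (r1 d + r1 j).
  pose r3 := upd r2 d (m (r2 d)).
  have r2d : r2 d = r i * n + r j by rewrite /r2 upd_eq /r1 upd_eq upd_lt // r0.
  have lN : r2 d < n.+1 * n.+1 by rewrite r2d; nia.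
  have lB : r2 d < B ^ 2.
    by apply: (leq_trans lN); apply: leq_trans nB2; rewrite expnS expn1.
  have lM := @B_lt 2 _ isT lB.
  exists r3; split; first by do 3!apply: agree_upd => //.
    by rewrite /r3 upd_eq mc // r2d !ag.
  apply/runsS; rewrite /= e1 ifT; last by rewrite r0; apply: leq_ltn_trans lM;
    rewrite r2d leq_addr.
  apply/runsS; rewrite /= e2 ifT -/r1; last by move: lM; rewrite {1}/r2 upd_eq.
  apply/runsS; rewrite /= e3 -/r2 ifT; last first.
    by apply: (leq_ltn_trans (m1 _)); apply: (@B_lt 1); rewrite ?expn1; lia.
  by rewrite -/r3 !addnS addn0; apply: runs0.
- rewrite /cond_code => /code_at_cat [ca /code_at_cons [e1 _]].
  have [r1 [ag1 r1d ru]] := addr_code_runs m g ag wc ca.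
  have [m1 _ mk] := mX.
  have [s4 a4] := key_small g wc.
  exists (upd r1 d (m (r1 d))); split; first exact: agree_upd.
    by rewrite upd_eq r1d mk.
  rewrite (_ : 12 = 11 + 1) //; apply: (runs_trans ru).
  apply/runsS; rewrite /step e1 ifT; last first.
    by apply: (leq_ltn_trans (m1 _)); apply: (@B_lt 1); rewrite ?expn1; lia.
  by rewrite size_cat addn1 addnS; apply: runs0.
Qed.

Lemma small_lt_M x : x <= n.+1 -> x < M.
Proof. by move=> xn; apply: (@B_lt 1) => //; rewrite expn1; lia. Qed.

Definition compiled (c : cmd) : Prop := forall rho r m X pc,
  good rho -> agree rho r -> represents m X -> wf (size rho) c ->
  let cs := compile (size rho) pc c in
  code_at P pc cs ->
  exists r' m', [/\ agree rho r', represents m' (sem n cell c rho X) &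
    runs (cost n.+1 c) (Running pc r m) (Running (pc + size cs) r' m')].

Lemma compiled_Put t args : compiled (Put t args).
Proof.
move=> rho r m X pc g ag mX wc cs /code_at_cat [ca /code_at_cons [e _]].
have [r1 [ag1 r1d ru]] := addr_code_runs m g ag wc ca.
exists r1, (upd m (addr (key rho t args)) 1); split=> //.
  exact: represents_put.
rewrite (_ : cost _ _ = 11 + 1) //; apply: (runs_trans ru).
apply/runsS; rewrite /step e r1d (agree_base g ag1) //.
by rewrite size_cat addn1 addnS; apply: runs0.
Qed.

Lemma compiled_If p c e : compiled e -> compiled (If p c e).
Proof.
move=> IH rho r m X pc g ag mX /= /andP[wc we].
set s := cond_code _ _; set s' := compile _ _ _; set l := _ + size s'.
move=> /code_at_cat [ca /code_at_cons [e1 ce]].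
have [r1 [ag1 r1d ru]] := cond_code_runs g ag mX wc ca.
have z : r1 3 = 0 by rewrite (agree_base g ag1).
have lE : pc + size (s ++ (if p then JumpEq (size rho) 3 l
                           else JumpLt 3 (size rho) l) :: s') = l.
  by rewrite size_cat /= /l; lia.
rewrite lE (_ : 13 + _ = 12 + (cost n.+1 e).+1); last by lia.
have jump : step M P (Running (pc + size s) r1 m) =
    Running (if test n cell rho X c == p then (pc + size s).+1 else l) r1 m.
  rewrite /step e1 -r1d; case: p {e1 lE}; rewrite z.
    by case: eqP.
  by rewrite lt0n; case: eqP.
case: ifP jump => _ jump; last first.
  exists r1, m; split=> //; apply: (runs_trans ru).
  by apply/runsS; rewrite jump; apply: runs0.
have [r2 [m2 [ag2 mX2 ru2]]] := IH rho r1 m X _ g ag1 mX we ce.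
exists r2, m2; split=> //; apply: (runs_trans ru).
by apply/runsS; rewrite jump.
Qed.

Lemma compiled_Seq e f : compiled e -> compiled f -> compiled (Seq e f).
Proof.
move=> IHe IHf rho r m X pc g ag mX /= /andP[we wf] /code_at_cat [ce cf].
have [r1 [m1 [ag1 mX1 ru1]]] := IHe rho r m X pc g ag mX we ce.
have [r2 [m2 [ag2 mX2 ru2]]] := IHf rho r1 m1 _ _ g ag1 mX1 wf cf.
exists r2, m2; split=> //.
by rewrite size_cat addnA; apply: runs_trans ru1 ru2.
Qed.

Lemma compiled_Pred i e : compiled e -> compiled (Pred i e).
Proof.
move=> IH rho r m X pc g ag mX /= /andP[si we] /code_at_cons [e1 ce].
have id : i < size rho by case/andP: si.
have E : r i - r 4 = (nth 0 rho i).-1.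
  have -> : r 4 = 1 by rewrite (agree_base g ag).
  by rewrite subn1 ag.
have le : (nth 0 rho i).-1 <= n.
  by apply: leq_trans (leq_pred _) (small_le g si).
have ag1 := @agree_rcons rho r (nth 0 rho i).-1 ag.
have g1 := good_rcons g le.
rewrite -(size_rcons rho (nth 0 rho i).-1) in we ce.
have [r1 [m1 [ag' mX' ru]]] := IH _ _ m X _ g1 ag1 mX we ce.
exists r1, m1; split=> //; first exact: agree_belast ag'.
apply/runsS; rewrite /step e1 E ifT; last by apply: small_lt_M; lia.
by rewrite -addSnnS -(size_rcons rho (nth 0 rho i).-1).
Qed.

Lemma compiled_For e : compiled e -> compiled (For e).
Proof.
move=> IH rho r m X pc g ag mX we cs.
rewrite /cs /compile -/compile; set d := size rho.
set s := compile _ _ e; set l := (pc.+2 + size s).+2.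
move=> /code_at_cons [e1 /code_at_cons [e2 /code_at_cat [ce]]].
move=> /code_at_cons [e3 /code_at_cons [e4 _]].
(* Here [k] counts the remaining iterations, and the extra 1 in the bound is the exit test. *)
have loop k : forall i r m X, i + k = n.+1 ->
    agree rho r -> r d = i -> represents m X ->
    exists r' m', [/\ agree rho r',
      represents m' (foldl (fun Y i => sem n cell e (rcons rho i) Y) X (iota i k)) &
      runs (1 + k * (3 + cost n.+1 e)) (Running pc.+1 r m) (Running l r' m')].
  elim: k => [|k IHk] i {ag mX}r {}m {}X ik ag rd mX.
    exists r, m; split=> //; apply/runsS; rewrite /step e2.
    by rewrite rd (agree_base g ag) // -[i]addn0 ik eqxx; apply: runs0.
  have i_n : i <= n by lia.
  have ag1 : agree (rcons rho i) r.
    move=> j; rewrite size_rcons ltnS leq_eqVlt nth_rcons => /orP[/eqP->|hj].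
      by rewrite ltnn eqxx.
    by rewrite hj ag.
  have [] := IH (rcons rho i) r m X pc.+2 (good_rcons g i_n) ag1 mX;
    rewrite size_rcons //.
  rewrite -/d -/s => r1 [m1 [ag2 mX1 ru]].
  have r1d : r1 d = i by rewrite ag2 ?size_rcons // nth_rcons ltnn eqxx.
  have ag3 := agree_belast ag2.
  have r14 : r1 4 = 1 by rewrite (agree_base g ag3).
  have [|||r2 [m2 [ag' mX' ru']]] // := IHk i.+1 (upd r1 d (r1 d + r1 4)) m1 _
    _ _ _ mX1.
  - by lia.
  - exact: agree_upd.
  - by rewrite upd_eq r1d r14 addn1.
  exists r2, m2; split=> //.
  rewrite (_ : 1 + _ = (cost n.+1 e + (1 + k * (3 + cost n.+1 e)).+2).+1);
    last by lia.
  apply/runsS; rewrite /step e2 rd (agree_base g ag) // ifF;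
    last by apply/eqP => /= ?; lia.
  apply: (runs_trans ru).
  apply/runsS; rewrite /step e3 ifT; last by rewrite r1d r14 addn1;
    apply: small_lt_M.
  by apply/runsS; rewrite /step e4.
have [||||r' [m' [ag' mX' ru]]] := loop n.+1 0 (upd r d 0) m X => //.
- exact: agree_upd.
- by rewrite upd_eq.
exists r', m'; split=> //=.
rewrite (_ : pc + _ = l); last by rewrite size_cat /l /=; lia.
rewrite (_ : _ + _ * _ = (1 + n.+1 * (3 + cost n.+1 e)).+1) //.
by apply/runsS; rewrite /step e1 ifT //; apply: small_lt_M.
Qed.

Lemma compile_correct c : compiled c.
Proof.
elim: c => [t args|p c e IH|e IHe f IHf|e IH|i e IH].
- exact: compiled_Put.
- exact: compiled_If.
- exact: compiled_Seq.
- exact: compiled_For.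
- exact: compiled_Pred.
Qed.

End Compile.

(** * Lexicographic transitive orientation *)

Section Orientation.
Variables (n : nat) (h : rel nat).
Hypothesis h_sym : symmetric h.
Hypothesis h_irr : irreflexive h.
Hypothesis h_lt : forall u v, h u v -> u < n /\ v < n.

(* The arcs that every transitive orientation of h must contain together with
   the arc (a, b). *)
Inductive forced (a b : nat) : nat -> nat -> Prop :=
| forced_refl : h a b -> forced a b a b
| forced_head c d d' :
    forced a b c d -> h c d' -> ~~ h d d' -> forced a b c d'
| forced_tail c c' d :
    forced a b c d -> h c' d -> ~~ h c c' -> forced a b c' d.

Lemma forced_h a b c d : forced a b c d -> h a b /\ h c d.
Proof. by elim=> // *; split; tauto. Qed.

Lemma forced_trans a b c d e f :
  forced a b c d -> forced c d e f -> forced a b e f.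
Proof.
move=> H; elim=> // {e f} [e f f'|e e' f] _ H1 h1 h2.
  exact: forced_head h1 h2.
exact: forced_tail h1 h2.
Qed.

Lemma forced_sym a b c d : forced a b c d -> forced c d a b.
Proof.
move=> H; elim: H (H) => {c d} [hab|c d d' H IH h1 h2|c c' d H IH h1 h2] _.
- exact: forced_refl.
- apply: forced_trans (IH H).
  apply: (forced_head (forced_refl h1)); first by have [] := forced_h H.
  by rewrite h_sym.
- apply: forced_trans (IH H).
  apply: (forced_tail (forced_refl h1)); first by have [] := forced_h H.
  by rewrite h_sym.
Qed.

Lemma forced_flip a b c d : forced a b c d -> forced b a d c.
Proof.
elim=> {c d} [hab|c d d' H IH h1 h2|c c' d H IH h1 h2].
- by apply: forced_refl; rewrite h_sym.
- by apply: forced_tail IH _ h2; rewrite h_sym.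
- by apply: forced_head IH _ h2; rewrite h_sym.
Qed.

(* Golumbic's triangle lemma. *)
Lemma triangle a b c b' c' : h a b -> h a c ->
  ~ forced b c b a -> ~ forced b c a c -> forced b c b' c' ->
  forced a b a b' /\ forced a c a c'.
Proof.
move=> hab hac nC nB; elim=> {b' c'} [|b' c' d H [IH1 IH2] h1 h2|b' d c' H [IH1
  IH2] h1 h2].
- by move=> _; split; apply: forced_refl.
(* If [h a d] fails, the arc (b', d) forces (b', a) and hence (b, a), putting (b, a) into the class
   of (b, c). The third case is its mirror image. *)
- split=> //; have [had|nad] := boolP (h a d).
    exact: forced_head IH2 had h2.
  case: nC; apply: forced_trans (forced_trans _ (forced_flip (forced_sym IH1))).
    exact: forced_head H h1 h2.
  apply: (forced_head (forced_refl h1)); last by rewrite h_sym.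
  by rewrite h_sym; have [] := forced_h IH1.
- split=> //; have [had|nad] := boolP (h a d).
    exact: forced_head IH1 had h2.
  case: nB; apply: forced_trans (forced_trans _ (forced_sym IH2)).
    exact: forced_tail H h1 h2.
  apply: (forced_tail (forced_refl h1)); last by rewrite h_sym.
  by have [] := forced_h IH2.
Qed.

Definition lexlt (p q p' q' : nat) : bool := (p < p') || (p == p') && (q < q').

(* The orientation in which the lexicographically first pair p < q of every
   forcing class points from p to q. *)
Definition lexarc (u v : nat) : Prop :=
  exists p q, [/\ p < q, forced p q u v &
    forall p' q', p' < q' -> forced p' q' v u -> lexlt p q p' q'].

Lemma lexarc_h u v : lexarc u v -> h u v.
Proof. by case=> p [q [_ /forced_h[]]]. Qed.

Lemma lexarc_lt u v : lexarc u v -> u < n /\ v < n.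
Proof. by move/lexarc_h/h_lt. Qed.

Lemma lexarc_forced u v u' v' : lexarc u v -> forced u v u' v' -> lexarc u' v'.
Proof.
case=> p [q [pq H L]] F; exists p, q; split=> //; first exact: forced_trans F.
move=> p' q' pq' F'; apply: L => //; apply: forced_trans F' _.
exact/forced_flip/forced_sym.
Qed.

Lemma lexarc_asym u v : lexarc u v -> ~ lexarc v u.
Proof.
case=> p [q [pq H L]] [p' [q' [pq' H' L']]].
have := L _ _ pq' H'; have := L' _ _ pq H; rewrite /lexlt; lia.
Qed.

Hypothesis lexarc_total : forall u v, h u v -> lexarc u v \/ lexarc v u.

Definition cyclic_triangle a b c := [/\ lexarc a b, lexarc b c & lexarc c a].

(** The hypotheses of [triangle] hold because [lexarc] is constant on classes and asymmetric: an arc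
    of a cyclic triangle may be exchanged for any arc of its class, the opposite vertex staying
    fixed. *)
Lemma cyclic_triangle_replace a b c b' c' :
  cyclic_triangle a b c -> forced b c b' c' -> cyclic_triangle a b' c'.
Proof.
move=> [ab bc ca] F.
have [] := @triangle a b c b' c' (lexarc_h ab) _ _ _ F.
- by rewrite h_sym; apply: lexarc_h.
- by move/(lexarc_forced bc)/lexarc_asym; apply.
- by move/(lexarc_forced bc)/lexarc_asym; apply.
move=> F1 F2; split; first exact: lexarc_forced F1.
  exact: lexarc_forced F.
by apply: lexarc_forced ca _; apply: forced_flip.
Qed.

(** Descent on the increasing arc (b, c) in lexicographic order, which [b * n.+1 + c] encodes for
    vertices below [n]. If a < b, a rotation already exhibits the smaller arc (a, b). *)
Lemma no_cyclic_triangle_up a b c : b < c -> ~ cyclic_triangle a b c.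
Proof.
have [k] := ubnP (b * n.+1 + c); elim: k => // k IH in a b c *.
move=> bk bc [arcab arcbc arcca].
have [[aN bN] [_ cN]] := (lexarc_lt arcab, lexarc_lt arcbc).
have [ab|ba|/esym eab] := ltngtP a b; first 1 last.
(* As (a, b) points downwards, the first pair p < q of its class precedes (b, a). Exchanging (a, b)
   for (p, q) gives the cyclic triangle c, p, q, which is smaller unless p = b; in that case it
   contains the arc (c, b), against (b, c). *)
- have := arcab; case=> p [q [pq F L]].
  have Fba := forced_refl (lexarc_h arcab).
  have := L _ _ ba (forced_flip Fba) => lpq.
  have [epb|npb] := eqVneq p b.
    move: F; rewrite epb => F.
    have [cp _ _] : cyclic_triangle c b q.
      by apply: cyclic_triangle_replace (forced_sym F).
    exact: lexarc_asym arcbc cp.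
  apply: (IH c p q) => //; last first.
    by apply: cyclic_triangle_replace (forced_sym F).
  have [pN qN] := h_lt (forced_h F).1.
  move: lpq bk; rewrite /lexlt (negbTE npb) /= orbF; nia.
- by have := lexarc_h arcab; rewrite eab h_irr.
- apply: (IH c a b) => //; move: bk; nia.
Qed.

Lemma no_cyclic_triangle a b c : ~ cyclic_triangle a b c.
Proof.
move=> T; have [ab bc ca] := T.
have := @no_cyclic_triangle_up a b c; have := @no_cyclic_triangle_up b c a.
have := @no_cyclic_triangle_up c a b.
have neq u v : lexarc u v -> u != v.
  by move/lexarc_h; apply: contraTneq => ->; rewrite h_irr.
have := neq _ _ ab; have := neq _ _ bc; have := neq _ _ ca.
have [b_lt|b_gt|->] := ltngtP b c; [by move=> _ _ _ _ _ /(_ isT)| |by []].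
have [ab_lt|ab_gt|->] := ltngtP a b; [by move=> _ _ _ /(_ isT); case| |by []].
have -> : (c < a) = true by lia.
by move=> _ _ _ _ /(_ isT); case.
Qed.

(** Were [h a c] false, (a, b) would force (c, b); if it is true, the wrong direction closes a
    cyclic triangle. *)
Lemma lexarc_trans a b c : lexarc a b -> lexarc b c -> lexarc a c.
Proof.
move=> ab bc; have [hac|nhac] := boolP (h a c).
  by case: (lexarc_total hac) => // ca; case: (@no_cyclic_triangle a b c).
case: (lexarc_asym bc); apply: (lexarc_forced ab).
apply: (forced_tail (forced_refl (lexarc_h ab))) => //.
by rewrite h_sym; apply: lexarc_h.
Qed.

Lemma lexarc_irr u : ~ lexarc u u.
Proof. by move/lexarc_h; rewrite h_irr. Qed.

Hypothesis no_C4 : forall a b c d, h a b -> h c d ->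
  [|| h a c, h c b, h b d | h d a].

Definition dominates (u v : nat) : Prop := forall k, lexarc v k -> lexarc u k.

Lemma dominates_total u v : dominates u v \/ dominates v u.
Proof.
have [|/existsNP[k]] := pselect (dominates u v); first by left.
move/not_implyP=> [vk nuk]; right=> l ul; apply: contrapT => nvl.
(* Any edge of [h] linking {u, l} with {v, k}, however directed, yields by transitivity one of the
   missing arcs (u, k) and (v, l). *)
have := no_C4 (lexarc_h ul) (lexarc_h vk).
have e x y : h x y -> (lexarc x y -> False) -> (lexarc y x -> False) -> False.
  by move=> hxy nxy nyx; case: (lexarc_total hxy).
case/or4P=> /e; apply.
- by move/lexarc_trans/(_ vk).
- by move/lexarc_trans/(_ ul).
- exact: nvl.
- by move=> lv; apply: nuk; apply: lexarc_trans vk; apply: lexarc_trans lv.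
- by move=> lk; apply: nuk; apply: lexarc_trans lk.
- by move=> kl; apply: nvl; apply: lexarc_trans kl.
- by move=> ku; apply: nvl; apply: lexarc_trans ul; apply: lexarc_trans ku.
- exact: nuk.
Qed.

(* u ends before v does, ties being broken by the index. *)
Definition before (u v : nat) : Prop := dominates u v /\ (~ dominates v u \/ u < v).

Lemma before_irr u : ~ before u u.
Proof. by case=> lu [|]; [apply | rewrite ltnn]. Qed.

Lemma before_trans u v w : before u v -> before v w -> before u w.
Proof.
move=> [uv nvu] [vw nwv]; split=> [k /vw/uv //|].
case: nvu => [nvu|ltuv]; first by left=> wu; apply: nvu => k /wu/vw.
case: nwv => [nwv|ltvw]; first by left=> wu; apply: nwv => k /uv/wu.
by right; apply: ltn_trans ltvw.
Qed.

Lemma before_total u v : u != v -> before u v \/ before v u.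
Proof.
move=> uv; have [l1|l1] := pselect (dominates u v);
  have [l2|l2] := pselect (dominates v u).
- have [lt|lt|e] := ltngtP u v; [by left; split; auto|by right; split; auto|].
  by rewrite e eqxx in uv.
- by left; split; auto.
- by right; split; auto.
- by case: (dominates_total u v).
Qed.

(** An arc (c, v) is inherited by [u], which dominates [c]; an arc (v, c) would be inherited by [c],
    giving a loop. *)
Lemma before_h u c v : before u c -> before c v -> h c v -> h u v.
Proof.
move=> [uc _] [cv _] /lexarc_total[/uc/lexarc_h //|/cv/lexarc_irr[]].
Qed.

End Orientation.

(** * The program and its meaning *)

(* Relations: 0 nonadj; 1 forced; 2 lexarc; 3 the negation of dominates;
   4 may_follow; 5 separated; 6 the states (last black, last white, blacks
   missing, whites missing) of the dynamic program, with n for no vertex;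
   7 the answer.  The loops bind the registers 6, 7, ... from the outside in. *)
Definition nonadjacency : cmd :=
  For (For (If true (Lt 6 7) (If true (Lt 7 0) (If false (Adj 6 7)
    (Seq (Put 0 [:: 6; 7; 3; 3]) (Put 0 [:: 7; 6; 3; 3])))))).

Definition forcing : cmd :=
  For (For (For
    (If true (In 0 [:: 6; 7; 3; 3]) (If true (In 0 [:: 6; 8; 3; 3])
    (If false (In 0 [:: 7; 8; 3; 3])
    (Seq (Put 1 [:: 6; 7; 6; 8]) (Put 1 [:: 7; 6; 8; 6]))))))).

Definition closure_step : cmd :=
  For (For (For (For
    (If true (In 1 [:: 8; 9; 6; 7]) (If true (In 1 [:: 6; 7; 10; 11])
    (Put 1 [:: 8; 9; 10; 11])))))).

Definition closure : cmd := For (For closure_step).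

Definition orient_step : cmd :=
  If true (Lt 6 7) (For (For
    (If true (In 1 [:: 6; 7; 8; 9]) (If false (In 2 [:: 9; 8; 3; 3])
    (Put 2 [:: 8; 9; 3; 3]))))).

Definition orient : cmd := For (For orient_step).

Definition not_le : cmd :=
  For (For (For
    (If true (In 2 [:: 7; 8; 3; 3]) (If false (In 2 [:: 6; 8; 3; 3])
    (Put 3 [:: 6; 7; 3; 3]))))).

(** Register 0 holds [n], so the first [Put] lets every vertex follow the absence of a vertex. *)
Definition precedence : cmd :=
  For (For (If true (Lt 7 0) (Seq (Put 4 [:: 0; 7; 3; 3])
    (If true (Lt 6 0) (If false (In 3 [:: 6; 7; 3; 3]) (Seq
      (If true (In 3 [:: 7; 6; 3; 3]) (Put 4 [:: 6; 7; 3; 3]))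
      (If true (Lt 6 7) (Put 4 [:: 6; 7; 3; 3])))))))).

Definition separation : cmd :=
  For (For (If true (Lt 7 0) (Seq (Put 5 [:: 0; 7; 3; 3])
    (If true (In 0 [:: 6; 7; 3; 3]) (Put 5 [:: 6; 7; 3; 3]))))).

(** Registers 1 and 2 may exceed [n] and so cannot appear in a key; a search finds loop values equal
    to them. When [b] or [w] exceeds [n] no state is created, and the answer is no. *)
Definition start : cmd :=
  For (For (If false (Neq 6 1) (If false (Neq 7 2)
    (Put 6 [:: 0; 0; 6; 7])))).

(** Below the round counter in register 6, registers 7 to 11 hold the next vertex, the last black,
    the last white and both missing counts; register 12 receives a decremented count, where 0 stays
    0. *)
Definition color_step : cmd :=
  For (For (For (For (For
    (If true (In 6 [:: 8; 9; 10; 11])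
    (If true (In 4 [:: 8; 7; 3; 3]) (If true (In 4 [:: 9; 7; 3; 3])
    (Seq
      (If true (In 5 [:: 9; 7; 3; 3]) (Pred 10 (Put 6 [:: 7; 9; 12; 11])))
      (If true (In 5 [:: 8; 7; 3; 3]) (Pred 11 (Put 6 [:: 8; 7; 10; 12]))))))))))).

Definition coloring : cmd := For color_step.

Definition answer : cmd :=
  For (For (If true (In 6 [:: 6; 7; 3; 3]) (Put 7 [:: 3; 3; 3; 3]))).

Definition main : cmd :=
  foldr Seq answer [:: nonadjacency; forcing; closure; orient; not_le;
    precedence; separation; start; coloring].

Lemma main_wf : wf 6 main. Proof. by []. Qed.
Lemma main_depth : depth main = 6. Proof. by []. Qed.

(** * Proof rules for loops over growing relations *)

Section Loops.
Variables (n : nat) (cell : nat -> nat).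
Notation sem := (sem n cell).
Implicit Types (X Y Z : rels) (rho : seq nat).

Lemma sem_incr c rho X k : X k -> sem c rho X k.
Proof.
elim: c rho X => [t args|p c e IH|e IHe f IHf|e IH|i e IH] rho X.
- by move=> /= ->; rewrite orbT.
- by move=> /=; case: ifP => // _; apply: IH.
- by move=> ?; apply/IHf/IHe.
- suff H s : forall X, X k -> foldl (fun Y i => sem e (rcons rho i) Y) X s k.
    exact: H.
  by elim: s => //= i s IHs {}X Xk; apply/IHs/IH.
- exact: IH.
Qed.

Definition incr (Q : rels -> Prop) : Prop :=
  forall Y Z, (forall k, Y k -> Z k) -> Q Y -> Q Z.

Lemma For_inv (I : nat -> rels -> Prop) e rho X :
  (forall i Y, i <= n -> I i Y -> I i.+1 (sem e (rcons rho i) Y)) ->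
  I 0 X -> I n.+1 (sem (For e) rho X).
Proof.
move=> step I0.
have H k : forall i Y, i + k = n.+1 -> I i Y ->
    I n.+1 (foldl (fun Y i => sem e (rcons rho i) Y) Y (iota i k)).
  elim: k => [|k IHk] i Y /=; first by rewrite addn0 => <-.
  by move=> ik Ii; apply: IHk; [lia|apply: step => //; lia].
exact: H.
Qed.

(** [I] is used for soundness and [Q] for completeness. When [Q] is upward closed ([incr]), what one
    iteration establishes survives all later ones. *)
Definition spec (I : rels -> Prop) c rho (Q : rels -> Prop) : Prop :=
  forall X, I X -> I (sem c rho X) /\ Q (sem c rho X).

Lemma incr_all (Q : nat -> rels -> Prop) :
  (forall i, incr (Q i)) -> incr (fun Y => forall i, i <= n -> Q i Y).
Proof. by move=> up Y Z YZ H i i_n; apply: up YZ (H i i_n). Qed.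

Lemma spec_For I e rho (Q : nat -> rels -> Prop) :
  (forall i, incr (Q i)) ->
  (forall i, i <= n -> spec I e (rcons rho i) (Q i)) ->
  spec I (For e) rho (fun Y => forall i, i <= n -> Q i Y).
Proof.
move=> up step X IX.
have [] : I (sem (For e) rho X) /\
    forall i, i < n.+1 -> Q i (sem (For e) rho X) by
  apply: (For_inv (I := fun i Y => I Y /\ forall j, j < i -> Q j Y)) => //;
  move=> i Y i_n [IY QY]; have [IY' QY'] := step i i_n Y IY; split=> // j;
  rewrite ltnS leq_eqVlt => /orP[/eqP->//|/QY];
  apply: up => k; apply: sem_incr.
by [].
Qed.

Definition kept (t : nat) X Y : Prop :=
  forall t' ds, t' != t -> Y (t' :: ds) = X (t' :: ds).

Definition extends (t : nat) (X0 : rels) (S : seq nat -> Prop) X : Prop :=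
  kept t X0 X /\
  (forall ds, X (t :: ds) -> S ds).

Lemma semPut t args rho X k :
  sem (Put t args) rho X k = (k == key rho t args) || X k.
Proof. by []. Qed.

Lemma extends_put t X0 S rho args X :
  S (map (nth 0 rho) args) -> extends t X0 S X ->
  extends t X0 S (sem (Put t args) rho X).
Proof.
move=> Sa [fr so]; split=> [t' ds tt'|ds]; rewrite semPut /key eqseq_cons.
  by rewrite (negbTE tt') fr.
by rewrite eqxx /= => /orP[/eqP->//|/so].
Qed.

Lemma semIf p c e rho X :
  sem (If p c e) rho X = if test n cell rho X c == p then sem e rho X else X.
Proof. by []. Qed.

Lemma semSeq e f rho X : sem (Seq e f) rho X = sem f rho (sem e rho X).
Proof. by []. Qed.

Lemma semPred i e rho X :
  sem (Pred i e) rho X = sem e (rcons rho (nth 0 rho i).-1) X.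
Proof. by []. Qed.

End Loops.
Arguments sem : simpl never.

(** * From the adjacency matrix to the linear order *)

Section Phases.
Variables (n blacks whites : nat) (cell : nat -> nat).
Notation sem := (sem n cell).
Notation rho0 := (base n blacks whites).
Implicit Types (X Y Z : rels).

Definition nonadj : rel nat :=
  fun u v => [&& u < n, v < n, u != v & cell (u * n + v) == 0].

Notation h := nonadj.

Hypothesis h_sym : symmetric h.

Lemma nonadj_irr : irreflexive h.
Proof. by move=> u; rewrite /nonadj eqxx !andbF. Qed.

Lemma nonadj_lt u v : h u v -> u < n /\ v < n.
Proof. by case/and4P. Qed.

Definition tuple2 (R : nat -> nat -> Prop) (ds : seq nat) : Prop :=
  if ds is [:: u; v; 0; 0] then R u v else False.

Definition tuple4 (R : nat -> nat -> nat -> nat -> Prop) (ds : seq nat) : Prop :=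
  if ds is [:: u; v; p; q] then R u v p q else False.

Definition empty_rel (t : nat) X : Prop := forall ds, ~~ X (t :: ds).

Lemma nonadjacency_ok X : empty_rel 0 X ->
  kept 0 X (sem nonadjacency rho0 X) /\
  forall u v, u <= n -> v <= n ->
    sem nonadjacency rho0 X [:: 0; u; v; 0; 0] = h u v.
Proof.
move=> e0.
pose I := extends 0 X (tuple2 h).
pose Q u v Y := h u v -> u < v -> Y [:: 0; u; v; 0; 0] /\ Y [:: 0; v; u; 0; 0].
have upQ u v : incr (Q u v).
  by move=> Y Z YZ H huv uv; have [/YZ ? /YZ] := H huv uv.
have S : spec n cell I nonadjacency rho0
    (fun Y => forall u, u <= n -> forall v, v <= n -> Q u v Y).
  apply: spec_For => [u|u un]; first exact: incr_all.
  apply: spec_For => [//|v vn] Y IY.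
  rewrite !semIf semSeq /= !eqb_id eqbF_neg negbK.
  have [uv|vu] := ltnP u v; last by split=> // _; lia.
  have [ltvn|gevn] := ltnP v n; last by split=> // /nonadj_lt; lia.
  case: ifP => [c0|nc0]; last by split=> // /and4P[_ _ _]; rewrite nc0.
  have huv : h u v by apply/and4P; split=> //; lia.
  split; last by move=> _ _; rewrite !semPut /= !eqxx ?orbT.
  apply: extends_put; first by rewrite /= h_sym.
  exact: extends_put.
have [|[fr so] q] := S X.
  by split=> // ds; rewrite (negbTE (e0 ds)).
split=> // u v un vn; apply/idP/idP => [/so//|huv]; have [uv|vu|e] := ltngtP u v.
- by have [] := q u un v vn huv uv.
- by have [] := q v vn u un _ vu; rewrite // h_sym.
- by move: huv; rewrite e nonadj_irr.
Qed.


Lemma extends_empty t X S : empty_rel t X -> extends t X S X.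
Proof. by move=> e; split=> // ds; rewrite (negbTE (e ds)). Qed.

Lemma forcing_ok X : empty_rel 1 X ->
  (forall u v, u <= n -> v <= n -> X [:: 0; u; v; 0; 0] = h u v) ->
  [/\ kept 1 X (sem forcing rho0 X),
     forall ds, sem forcing rho0 X (1 :: ds) -> tuple4 (forced h) ds &
     forall a b c, h a b -> h a c -> ~~ h b c ->
       sem forcing rho0 X [:: 1; a; b; a; c] /\
       sem forcing rho0 X [:: 1; b; a; c; a]].
Proof.
move=> e1 XH.
pose I := extends 1 X (tuple4 (forced h)).
pose Q a b c Y := h a b -> h a c -> ~~ h b c ->
  Y [:: 1; a; b; a; c] /\ Y [:: 1; b; a; c; a].
have upQ a b c : incr (Q a b c).
  by move=> Y Z YZ H hab hac hbc; have [/YZ ? /YZ] := H hab hac hbc.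
have S : spec n cell I forcing rho0 (fun Y => forall a, a <= n ->
    forall b, b <= n -> forall c, c <= n -> Q a b c Y).
  apply: spec_For => [a|a an]; first by do 2!apply: incr_all => ?.
  apply: spec_For => [b|b bn]; first by apply: incr_all.
  apply: spec_For => [//|c cn] Y IY; have [fr _] := IY.
  rewrite !semIf semSeq /= !eqb_id eqbF_neg /key /= !fr // !XH //.
  case: ifP => [hab|nhab]; last by split=> //; rewrite /Q nhab.
  case: ifP => [hac|nhac]; last by split=> //; rewrite /Q nhac.
  case: ifP => [hbc|nhbc]; last by split=> // _ _; rewrite nhbc.
  split; last by move=> _ _; rewrite !semPut /= !eqxx ?orbT.
  apply: extends_put; last apply: extends_put => //.
    apply: (forced_tail (forced_refl _)) hbc; rewrite h_sym //.
  exact: (forced_head (forced_refl hab)).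
have [|[fr so] q] := S X; first exact: extends_empty.
split=> // a b c hab hac hbc; have [an bn] := nonadj_lt hab;
  have [_ cn] := nonadj_lt hac.
by apply: q => //; apply: ltnW.
Qed.

(** Warshall's invariant, with [D] the set of pivots already processed. *)
Definition closed_through (D : nat -> nat -> Prop) X Y : Prop :=
  [/\ kept 1 X Y, forall k, X k -> Y k,
     forall ds, Y (1 :: ds) -> tuple4 (forced h) ds &
     forall a b c d z z', D z z' ->
       Y [:: 1; a; b; z; z'] -> Y [:: 1; z; z'; c; d] -> Y [:: 1; a; b; c; d]].

Lemma closed_through_sub (D D' : nat -> nat -> Prop) X Y :
  (forall z z', z < n -> z' < n -> D' z z' -> D z z') ->
  closed_through D X Y -> closed_through D' X Y.
Proof.
move=> DD' [fr XY so cl]; split=> // a b c d z z' D'z Yz Yz'.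
have [_ /nonadj_lt[zn z'n]] := forced_h (so _ Yz).
by apply: cl (Yz) (Yz'); apply: DD'.
Qed.

(* Within one round the rows and the column of the pivot do not change, which
   is why updating the relation in place is harmless. *)
Lemma closure_step_ok D X Y k k' : k <= n -> k' <= n ->
  closed_through D X Y ->
  closed_through (fun z z' => D z z' \/ z = k /\ z' = k') X
    (sem closure_step (rcons (rcons rho0 k) k') Y).
Proof.
move=> kn k'n [fr XY so cl].
pose N a b c d := Y [:: 1; a; b; c; d] \/
  Y [:: 1; a; b; k; k'] /\ Y [:: 1; k; k'; c; d].
pose I Z := extends 1 Y (tuple4 N) Z /\ forall k, Y k -> Z k.
pose Q a b c d Z := Y [:: 1; a; b; k; k'] -> Y [:: 1; k; k'; c; d] ->
  Z [:: 1; a; b; c; d] : Prop.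
have upQ a b c d : incr (Q a b c d) by move=> ? ? YZ H ? ?; apply/YZ/H.
have S : spec n cell I closure_step (rcons (rcons rho0 k) k')
    (fun Y => forall a, a <= n -> forall b, b <= n -> forall c, c <= n ->
      forall d, d <= n -> Q a b c d Y).
  apply: spec_For => [a|a an]; first by do 3!apply: incr_all => ?.
  apply: spec_For => [b|b bn]; first by do 2!apply: incr_all => ?.
  apply: spec_For => [c|c cn]; first by apply: incr_all.
  apply: spec_For => [//|d dn] Z [IZ YZ]; have [_ soZ] := IZ.
  split; last first.
    move=> Y1 Y2; rewrite !semIf /= !eqb_id /key /=.
    by rewrite (YZ _ Y1) (YZ _ Y2) semPut eqxx.
  split; last by move=> x Yx; apply/sem_incr/YZ.
  rewrite !semIf /= !eqb_id /key /=; case: ifP => // Z1; case: ifP => // Z2.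
  apply: extends_put => //=; right; split.
    by case: (soZ _ Z1) => [|[]].
  by case: (soZ _ Z2) => [|[]].
have YN ds : Y (1 :: ds) -> tuple4 N ds.
  move=> H; have := so _ H; case: ds H => [|? [|? [|? [|? [|]]]]] //= H _.
  by left.
have [|[[frY soY] incY] q] := S Y; first by [].
set Z := sem _ _ _ in frY soY incY q *.
have ZN a b c d : Z [:: 1; a; b; c; d] -> N a b c d by move/soY.
split=> [t ds t1|x /XY/incY //|ds Zds|a b c d z z'].
- by rewrite frY ?fr.
- have := soY _ Zds; case: ds Zds => [|? [|? [|? [|? [|]]]]] //= _ [/so //|].
  by move=> [/so H1 /so]; apply: forced_trans.
- have qq x y x' y' : Y [:: 1; x; y; k; k'] -> Y [:: 1; k; k'; x'; y'] ->
      Z [:: 1; x; y; x'; y'].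
    move=> Y1 Y2; have [/nonadj_lt[? ?] _] := forced_h (so _ Y1).
    have [_ /nonadj_lt[? ?]] := forced_h (so _ Y2).
    by apply: q => //; apply: ltnW.
  have Zk x y : Z [:: 1; x; y; k; k'] -> Y [:: 1; x; y; k; k'] by move/ZN=> [|[]].
  have Zk' x y : Z [:: 1; k; k'; x; y] -> Y [:: 1; k; k'; x; y] by move/ZN=> [|[]].
  case=> [Dz|[-> ->] /Zk + /Zk']; last exact: qq.
  move=> /ZN[Y1|[Y1 Y1']] /ZN[Y2|[Y2 Y2']].
  + by apply: incY; apply: cl Dz Y1 Y2.
  + by apply: qq Y2'; apply: cl Dz Y1 Y2.
  + by apply: qq Y1 _; apply: cl Dz Y1' Y2.
  + exact: qq.
Qed.

Lemma closure_ok X :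
  (forall ds, X (1 :: ds) -> tuple4 (forced h) ds) ->
  (forall a b c, h a b -> h a c -> ~~ h b c ->
     X [:: 1; a; b; a; c] /\ X [:: 1; b; a; c; a]) ->
  kept 1 X (sem closure rho0 X) /\
  forall a b c d, sem closure rho0 X [:: 1; a; b; c; d] <-> forced h a b c d.
Proof.
move=> so g.
have [fr XY soY cl] : closed_through (fun z z' => z < n.+1) X (sem closure rho0 X).
  apply: (For_inv (I := fun i => closed_through (fun z z' => z < i) X)).
    move=> k Y kn CY.
    suff : closed_through (fun z z' => z < k \/ z = k /\ z' < n.+1) X
        (sem (For closure_step) (rcons rho0 k) Y).
      by apply: closed_through_sub => z z' zn z'n; lia.
    apply: (For_inv (I := fun i => closed_through (fun z z' => z < k \/ z = k
      /\ z' < i) X)).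
      move=> k' Z k'n CZ; apply: closed_through_sub (closure_step_ok kn k'n CZ).
      by move=> z z' _ _; lia.
    by apply: closed_through_sub CY => z z' _ _; lia.
  by split.
split=> // a b c d; split=> [/soY //|];
  elim=> {c d} [hab|c d d' H IH h1 h2|c c' d H IH h1 h2].
(* Reflexivity is the immediate forcing with equal heads, as [h b b] is false. *)
- by apply/XY; have [] := g a b b hab hab _; rewrite ?nonadj_irr.
- have [_ hcd] := forced_h H; apply: cl IH _; first by have := nonadj_lt hcd; lia.
  by apply: XY; have [] := g _ _ _ hcd h1 h2.
- have [_ hcd] := forced_h H; apply: cl IH _; first by have := nonadj_lt hcd; lia.
  by apply: XY; rewrite h_sym in hcd; rewrite h_sym in h1;
    have [] := g _ _ _ hcd h1 h2.
Qed.


Hypothesis no_flip : forall u v, ~ forced h u v v u.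

(** [lexarc] as far as the pairs in [D] reveal it. As [D] grows in lexicographic order, the first
    pair met in a class is its first pair altogether, so no arc is ever revised. *)
Definition lexarc_within (D : nat -> nat -> Prop) (u v : nat) : Prop :=
  exists p q, [/\ D p q, p < q, forced h p q u v &
    forall p' q', D p' q' -> p' < q' -> forced h p' q' v u ->
      lexlt p q p' q'].

Definition oriented (D : nat -> nat -> Prop) X Y : Prop :=
  [/\ kept 2 X Y, forall ds, Y (2 :: ds) -> tuple2 (lexarc_within D) ds &
     forall p q u v, D p q -> p < q -> forced h p q u v ->
       Y [:: 2; u; v; 0; 0] \/ Y [:: 2; v; u; 0; 0]].

Lemma tuple2_sub (R R' : nat -> nat -> Prop) ds :
  (forall u v, R u v -> R' u v) -> tuple2 R ds -> tuple2 R' ds.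
Proof. by move=> RR'; case: ds => [|u [|v [|[|?] [|[|?] [|]]]]] //=;
  apply: RR'. Qed.

Lemma oriented_ext D D' X Y :
  (forall p q, p < q -> q < n -> D p q <-> D' p q) ->
  oriented D X Y -> oriented D' X Y.
Proof.
move=> DD' [fr so cp]; split=> //; last first.
  move=> p q u v D'pq pq F; apply: cp (pq) (F); apply/DD' => //.
  by have [/nonadj_lt[]] := forced_h F.
move=> ds /so; apply: tuple2_sub => u v [p [q [Dpq pq F L]]].
exists p, q; split=> //.
  by apply/DD' => //; have [/nonadj_lt[]] := forced_h F.
move=> p' q' Dpq' pq' F'; apply: L => //; apply/DD' => //.
by have [/nonadj_lt[]] := forced_h F'.
Qed.

Lemma orient_step_ok D X Y k k' : k <= n -> k' <= n ->
  (forall a b c d, X [:: 1; a; b; c; d] <-> forced h a b c d) ->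
  (forall p q, D p q -> lexlt p q k k') ->
  oriented D X Y ->
  oriented (fun p q => D p q \/ p = k /\ q = k') X
    (sem orient_step (rcons (rcons rho0 k) k') Y).
Proof.
move=> kn k'n XT Dk OY; rewrite semIf /= eqb_id.
have [kk'|k'k] := ltnP k k'; last first.
  by apply: oriented_ext OY => p q pq _; split; [left | case=> // -[]; lia].
have [fr so cp] := OY; pose D' p q := D p q \/ p = k /\ q = k'.
pose I Z := extends 2 X (tuple2 (lexarc_within D')) Z /\ forall k, Y k -> Z k.
pose Q u v Z := forced h k k' u v ->
  Z [:: 2; u; v; 0; 0] \/ Z [:: 2; v; u; 0; 0].
have upQ u v : incr (Q u v).
  by move=> ? ? YZ H F; have [/YZ|/YZ] := H F; [left|right].
have S : spec n cell I (For (For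
    (If true (In 1 [:: 6; 7; 8; 9]) (If false (In 2 [:: 9; 8; 3; 3])
    (Put 2 [:: 8; 9; 3; 3]))))) (rcons (rcons rho0 k) k')
    (fun Z => forall u, u <= n -> forall v, v <= n -> Q u v Z).
  apply: spec_For => [u|u un]; first by apply: incr_all.
  apply: spec_For => [//|v vn] Z [IZ YZ]; have [frZ soZ] := IZ.
  rewrite !semIf /= !eqb_id eqbF_neg /key /= frZ //.
  case: ifP => [/XT F|nF]; last by split=> // /XT; rewrite nF.
  case: ifP => [nvu|/negbFE vu]; last by split=> // _; right.
  split; last by move=> _; left; rewrite semPut eqxx.
  split; last by move=> x Yx; apply/sem_incr/YZ.
  apply: extends_put => //=.
  (* For a new arc, an earlier pair in the reversed class would already have oriented it one way or
     the other; and (k, k') itself cannot lie in both classes, by [no_flip]. *)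
  have [/soZ //|nuv] := boolP (Z [:: 2; u; v; 0; 0]).
  exists k, k'; split=> //; first by right.
  move=> p q [Dpq|[-> ->]] pq F'.
    by have [/YZ|/YZ] := cp _ _ _ _ Dpq pq F'; rewrite ?(negbTE nvu) ?(negbTE nuv).
  case: (@no_flip u v); apply: forced_trans F'; exact: forced_sym.
have [|[[frZ soZ] YZ] q] := S Y.
  split=> //; split=> // ds /so; apply: tuple2_sub => u v [p [q [Dpq pq F L]]].
  exists p, q; split=> //; first by left.
  by move=> p' q' [D'pq|[-> ->]] pq' F'; [apply: L | apply: Dk].
split=> // p q' u v [Dpq|[-> ->]] pq F.
  by have [/YZ|/YZ] := cp _ _ _ _ Dpq pq F; [left|right].
have [_ /nonadj_lt[un vn]] := forced_h F.
by apply: q => //; apply: ltnW.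
Qed.

Lemma orient_ok X : empty_rel 2 X ->
  (forall a b c d, X [:: 1; a; b; c; d] <-> forced h a b c d) ->
  [/\ kept 2 X (sem orient rho0 X),
    forall u v, sem orient rho0 X [:: 2; u; v; 0; 0] <-> lexarc h u v &
    forall u v, h u v -> lexarc h u v \/ lexarc h v u].
Proof.
move=> e2 XT.
have [fr so cp] : oriented (fun p q => p < n.+1) X (sem orient rho0 X).
  apply: (For_inv (I := fun i => oriented (fun p q => p < i) X)).
    move=> k Y kn OY.
    suff : oriented (fun p q => p < k \/ p = k /\ q < n.+1) X
        (sem (For orient_step) (rcons rho0 k) Y).
      by apply: oriented_ext => p q pq qn; lia.
    apply: (For_inv (I := fun i => oriented (fun p q => p < k \/ p = k /\ q <
      i) X)).
      move=> k' Z k'n OZ; apply: oriented_ext (orient_step_ok kn k'n XT _ OZ).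
        by move=> p q _ _; lia.
      by move=> p q; rewrite /lexlt; lia.
    by apply: oriented_ext OY => p q _ _; lia.
  by split=> // ds; rewrite (negbTE (e2 ds)).
set Y := sem _ _ _ in fr so cp *.
have Yarc u v : Y [:: 2; u; v; 0; 0] -> lexarc h u v.
  move/so => [p [q [pn pq F L]]]; exists p, q; split=> // p' q' pq' F'.
  by apply: L => //; have [/nonadj_lt[]] := forced_h F'; lia.
have tot u v : h u v -> lexarc h u v \/ lexarc h v u.
  move=> huv; have [un vn] := nonadj_lt huv.
  have hvu : h v u by rewrite h_sym.
  have [uv|vu|e] := ltngtP u v; last by move: huv; rewrite e nonadj_irr.
    by have [|/Yarc|/Yarc] := cp u v u v _ uv (forced_refl huv); [lia|left|right].
  by have [|/Yarc|/Yarc] := cp v u v u _ vu (forced_refl hvu); [lia|right|left].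
split=> // u v; split=> [/Yarc //|auv]; have [p [q [pq F L]]] := auv.
have [/nonadj_lt[pn _] _] := forced_h F.
have [|//|/Yarc] := cp p q u v _ pq F; first by lia.
by move/(lexarc_asym auv).
Qed.


Lemma not_le_ok X : empty_rel 3 X ->
  (forall u v, X [:: 2; u; v; 0; 0] <-> lexarc h u v) ->
  kept 3 X (sem not_le rho0 X) /\
  forall i j, i <= n -> j <= n ->
    sem not_le rho0 X [:: 3; i; j; 0; 0] <-> ~ dominates h i j.
Proof.
move=> e3 XO.
pose I := extends 3 X (tuple2 (fun i j => ~ dominates h i j)).
pose Q i j k Y := lexarc h j k -> ~ lexarc h i k -> Y [:: 3; i; j; 0; 0] : Prop.
have upQ i j k : incr (Q i j k) by move=> ? ? YZ H ? ?; apply/YZ/H.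
have S : spec n cell I not_le rho0 (fun Y => forall i, i <= n ->
    forall j, j <= n -> forall k, k <= n -> Q i j k Y).
  apply: spec_For => [i|i i_n]; first by do 2!apply: incr_all => ?.
  apply: spec_For => [j|j jn]; first by apply: incr_all.
  apply: spec_For => [//|k kn] Y IY; have [fr _] := IY.
  rewrite !semIf /= !eqb_id eqbF_neg /key /= !fr //.
  case: ifP => [/XO jk|njk]; last by split=> // /XO; rewrite njk.
  case: ifP => [nik|/negbFE/XO ik]; last by split.
  split; last by move=> _ _; rewrite semPut eqxx.
  by apply: extends_put => //= ij; move/negP: nik; apply; apply/XO/ij.
have [|[fr so] q] := S X; first exact: extends_empty.
split=> // i j i_n jn; split=> [/so //|/existsNP[k /not_implyP[jk nik]]].
have [_ kn] := lexarc_lt nonadj_lt jk.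
exact: q i i_n j jn k (ltnW kn) jk nik.
Qed.

Definition may_follow (u v : nat) : Prop :=
  v < n /\ (u = n \/ u < n /\ before h u v).

Lemma precedence_ok X : empty_rel 4 X ->
  (forall i j, i <= n -> j <= n ->
     X [:: 3; i; j; 0; 0] <-> ~ dominates h i j) ->
  kept 4 X (sem precedence rho0 X) /\
  forall u v, u <= n -> v <= n ->
    sem precedence rho0 X [:: 4; u; v; 0; 0] <-> may_follow u v.
Proof.
move=> e4 XL.
pose I := extends 4 X (tuple2 may_follow).
pose Q u v Y := v < n -> Y [:: 4; n; v; 0; 0] /\
  (u < n -> before h u v -> Y [:: 4; u; v; 0; 0]).
have upQ u v : incr (Q u v).
  move=> ? ? YZ H vn; have [H1 H2] := H vn; split; first exact: YZ.
  by move=> un uv; apply/YZ/H2.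
have S : spec n cell I precedence rho0 (fun Y => forall u, u <= n ->
    forall v, v <= n -> Q u v Y).
  apply: spec_For => [u|u un]; first by apply: incr_all.
  apply: spec_For => [//|v vn] Y IY.
  rewrite semIf semSeq /= eqb_id.
  case: ifP => [ltvn|nvn]; last by split=> //; rewrite /Q nvn.
  set Y1 := sem (Put _ _) _ _.
  have Y1n : Y1 [:: 4; n; v; 0; 0] by rewrite /Y1 semPut /= eqxx.
  have IY1 : I Y1 by apply: extends_put => //; split=> //; left.
  move: Y1 Y1n IY1 => {IY}Y Yn IY; have [fr _] := IY.
  rewrite semIf semIf semSeq /= !eqb_id eqbF_neg /key /= fr //.
  case: ifP => [ltun|nun]; last by split=> // _; split=> //; rewrite nun.
  case: ifP => [/negP nuv|/negbFE /XL nuv]; last first.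
    by split=> // _; split=> // _ [/(nuv un vn)].
  have uv : dominates h u v by apply: contrapT => H; apply/nuv/XL.
  set Y1 := sem _ _ Y.
  have [Y1n IY1 Y1v] : [/\ Y1 [:: 4; n; v; 0; 0], I Y1 &
      ~ dominates h v u -> Y1 [:: 4; u; v; 0; 0]].
    rewrite /Y1 semIf /= eqb_id /key /= fr //.
    case: ifP => [/XL nvu|nvu]; last by split=> // /(XL _ _ vn un).2; rewrite nvu.
    split; [exact: sem_incr| |by rewrite semPut eqxx].
    by apply: extends_put => //=; split=> //; right; do !split=> //; left;
      apply: nvu.
  rewrite semIf /= eqb_id; case: ifP => [ltuv|nuv'].
    split; last by move=> _; split=> [|_ _]; [exact: sem_incr|rewrite semPut eqxx].
    by apply: extends_put => //=; split=> //; right; do !split=> //; right.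
  by split=> // _; split=> // _ [_ []]; [exact: Y1v|rewrite nuv'].
have [|[fr so] q] := S X; first exact: extends_empty.
split=> // u v un vn; split=> [/so //|[ltvn [->|[ltun uv]]]].
  by have [] := q n (leqnn n) v vn ltvn.
by have [_] := q u un v vn ltvn; apply.
Qed.

Definition separated (u v : nat) : Prop := v < n /\ (u = n \/ h u v).

Lemma separation_ok X : empty_rel 5 X ->
  (forall u v, u <= n -> v <= n -> X [:: 0; u; v; 0; 0] = h u v) ->
  kept 5 X (sem separation rho0 X) /\
  forall u v, u <= n -> v <= n ->
    sem separation rho0 X [:: 5; u; v; 0; 0] <-> separated u v.
Proof.
move=> e5 XH.
pose I := extends 5 X (tuple2 separated).
pose Q u v Y := v < n -> Y [:: 5; n; v; 0; 0] /\
  (h u v -> Y [:: 5; u; v; 0; 0]).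
have upQ u v : incr (Q u v).
  move=> ? ? YZ H vn; have [H1 H2] := H vn; split; first exact: YZ.
  by move=> uv; apply/YZ/H2.
have S : spec n cell I separation rho0 (fun Y => forall u, u <= n ->
    forall v, v <= n -> Q u v Y).
  apply: spec_For => [u|u un]; first by apply: incr_all.
  apply: spec_For => [//|v vn] Y IY.
  rewrite semIf semSeq /= eqb_id.
  case: ifP => [ltvn|nvn]; last by split=> //; rewrite /Q nvn.
  set Y1 := sem (Put _ _) _ _.
  have Y1n : Y1 [:: 5; n; v; 0; 0] by rewrite /Y1 semPut /= eqxx.
  have IY1 : I Y1 by apply: extends_put => //; split=> //; left.
  have [fr _] := IY1.
  rewrite semIf /= !eqb_id /key /= fr // XH //.
  case: ifP => [huv|nhuv]; last by split=> // _; split=> //; rewrite nhuv.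
  split; last by move=> _; split=> [|_]; [exact: sem_incr|rewrite semPut eqxx].
  by apply: extends_put => //=; split=> //; right.
have [|[fr so] q] := S X; first exact: extends_empty.
split=> // u v un vn; split=> [/so //|[ltvn [->|uv]]].
  by have [] := q n (leqnn n) v vn ltvn.
by have [_] := q u un v vn ltvn; apply.
Qed.

Lemma start_ok X : empty_rel 6 X ->
  [/\ kept 6 X (sem start rho0 X),
    forall ds, sem start rho0 X (6 :: ds) -> ds = [:: n; n; blacks; whites] &
    blacks <= n -> whites <= n ->
      sem start rho0 X [:: 6; n; n; blacks; whites]].
Proof.
move=> e6.
pose I := extends 6 X (eq^~ [:: n; n; blacks; whites]).
pose Q x y Y := x = blacks -> y = whites -> Y [:: 6; n; n; x; y] : Prop.
have upQ x y : incr (Q x y) by move=> ? ? YZ H ? ?; apply/YZ/H.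
have S : spec n cell I start rho0 (fun Y => forall x, x <= n ->
    forall y, y <= n -> Q x y Y).
  apply: spec_For => [x|x xn]; first by apply: incr_all.
  apply: spec_For => [//|y yn] Y IY.
  rewrite !semIf /= !eqbF_neg !negbK.
  case: ifP => [/eqP ex|nx]; last by split=> // e; rewrite e eqxx in nx.
  case: ifP => [/eqP ey|ny]; last by split=> // _ e; rewrite e eqxx in ny.
  split; last by move=> _ _; rewrite semPut eqxx.
  by apply: extends_put; rewrite //= ex ey.
have [|[fr so] q] := S X; first exact: extends_empty.
by split=> // bn wn; apply: q.
Qed.

End Phases.

(** * The dynamic program along the linear order *)

Section Coloring.
Variables (n blacks whites : nat) (cell : nat -> nat).
Notation sem := (sem n cell).
Notation rho0 := (base n blacks whites).
Notation h := (nonadj n cell).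
Implicit Types (X Y Z : rels) (B W U : {set 'I_n}).

Hypothesis h_sym : symmetric h.
Hypothesis arc_total : forall u v, h u v -> lexarc h u v \/ lexarc h v u.
Hypothesis no_C4 : forall a b c d, h a b -> h c d ->
  [|| h a c, h c b, h b d | h d a].

Let beforeT := @before_total n h h_sym (@nonadj_irr n cell) (@nonadj_lt n cell)
  arc_total no_C4.

Definition separates B W : Prop :=
  forall x y : 'I_n, x \in B -> y \in W -> h x y.

Definition last_of (a : nat) U : Prop :=
  (a = n /\ forall u, u \notin U) \/
  exists v : 'I_n, [/\ a = v, v \in U &
    forall u : 'I_n, u \in U -> u != v -> before h u v].

Lemma separates_sym B W : separates B W -> separates W B.
Proof. by move=> s x y xW yB; rewrite h_sym; apply: s. Qed.

Lemma last_of_le a U : last_of a U -> a <= n.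
Proof. by case=> [[-> _]//|[v [-> _ _]]]; apply: ltnW. Qed.

Lemma ex_last (v : 'I_n) U : v \in U -> exists2 m : 'I_n, m \in U &
  forall u : 'I_n, u \in U -> u != m -> before h u m.
Proof.
have [k] := ubnP #|U|; elim: k => // k IH in U v *; move=> Uk vU.
have [e|[x]] := finset.set_0Vmem (U :\ v).
  exists v => // u uU uv; have : u \in U :\ v by rewrite finset.in_setD1 uv.
  by rewrite e finset.inE.
case/(IH (U :\ v)) => [|m].
  by move: Uk; rewrite (cardsD1 v U) vU.
rewrite finset.in_setD1 => /andP[mv mU] mmax.
have [vm|mv'] := beforeT mv.
  exists v => // u uU uv; have [->//|um] := eqVneq u m.
  by apply: before_trans vm; apply: mmax; rewrite // finset.in_setD1 uv.
exists m => // u uU um; have [->//|uv] := eqVneq u v.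
by apply: mmax; rewrite // finset.in_setD1 uv.
Qed.

Lemma last_of_before a U (v u : 'I_n) :
  last_of a U -> may_follow n cell a v -> u \in U -> before h u v.
Proof.
move=> [[_ U0]|[m [-> mU mmax]]] [_ av] uU; first by have := U0 u; rewrite uU.
have mv : before h m v by case: av => [e|[]//]; have := ltn_ord m; rewrite e ltnn.
by have [->//|um] := eqVneq u m; apply: before_trans mv; apply: mmax.
Qed.

(** Why one comparison suffices: by [before_h], nonadjacency of [v] to the last vertex of [W] passes
    to all earlier ones. *)
Lemma last_of_separated c W (v u : 'I_n) :
  last_of c W -> may_follow n cell c v -> separated n cell c v ->
  u \in W -> h u v.
Proof.
move=> [[_ U0]|[m [-> mU mmax]]] [_ av] [_ sv] uU.
  by have := U0 u; rewrite uU.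
have mn : m <> n :> nat by have := ltn_ord m; lia.
case: sv => // hmv; case: av => // -[_ mv].
have [->//|um] := eqVneq u m.
exact: (before_h (@nonadj_irr n cell) arc_total (mmax u uU um) mv hmv).
Qed.

Lemma add_last a c B W (v : 'I_n) :
  separates B W -> last_of a B -> last_of c W ->
  may_follow n cell a v -> may_follow n cell c v -> separated n cell c v ->
  [/\ separates (v |: B) W, last_of v (v |: B) & v \notin B].
Proof.
move=> s la lc av cv scv; split.
- move=> x y /finset.setU1P[->|xB] yW; last exact: s.
  by rewrite h_sym; apply: last_of_separated scv yW.
- right; exists v; split=> // [|u /finset.setU1P[->|uB] uv].
  + by rewrite finset.setU11.
  + by rewrite eqxx in uv.
  + exact: last_of_before av uB.
- by apply/negP => /(last_of_before la av)/before_irr.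
Qed.

(** The converse of [add_last]: since [v] comes last among all colored vertices, both the last black
    and the last white vertex that remain precede it. *)
Lemma remove_last a c B W (v : 'I_n) :
  separates B W -> v \in B ->
  (forall u : 'I_n, u \in B :|: W -> u != v -> before h u v) ->
  last_of a (B :\ v) -> last_of c W ->
  [/\ may_follow n cell a v, may_follow n cell c v, separated n cell c v &
    last_of v B].
Proof.
move=> s vB vmax la lc; split.
- split=> //; case: la => [[-> _]|[m [-> + _]]]; first by left.
  rewrite finset.in_setD1 => /andP[mv mB]; right; split=> //.
  by apply: vmax; rewrite // finset.in_setU mB.
- split=> //; case: lc => [[-> _]|[m [-> mW _]]]; first by left.
  right; split=> //; apply: vmax; first by rewrite finset.in_setU mW orbT.
  by apply/eqP => e; have := s _ _ vB mW; rewrite e nonadj_irr.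
- split=> //; case: lc => [[-> _]|[m [-> mW _]]]; first by left.
  by right; rewrite h_sym; apply: s.
- right; exists v; split=> // u uB; apply: vmax.
  by rewrite finset.in_setU uB.
Qed.

(** Subtraction is truncated, so a missing count of 0 means at least as many vertices as
    demanded. *)
Definition reach (a c x y : nat) : Prop :=
  exists B W, [/\ separates B W, last_of a B, last_of c W,
    x = blacks - #|B| & y = whites - #|W|].

Lemma reach_black a c x y v : reach a c x y ->
  may_follow n cell a v -> may_follow n cell c v -> separated n cell c v ->
  reach v c x.-1 y.
Proof.
move=> [B [W [s la lc -> ->]]] av cv scv.
have vn : v < n by case: av.
have [s' l' vB] := @add_last a c B W (Ordinal vn) s la lc av cv scv.
by exists (Ordinal vn |: B), W; split=> //; rewrite finset.cardsU1 vB subnS.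
Qed.

Lemma reach_white a c x y v : reach a c x y ->
  may_follow n cell a v -> may_follow n cell c v -> separated n cell a v ->
  reach a v x y.-1.
Proof.
move=> [B [W [s la lc -> ->]]] av cv sav.
have vn : v < n by case: av.
have [s' l' vW] := @add_last c a W B (Ordinal vn) (separates_sym s) lc la cv av sav.
exists B, (Ordinal vn |: W); split=> //; last by rewrite finset.cardsU1 vW subnS.
exact: separates_sym.
Qed.

Definition explored (X : rels) (t : nat) (Y : rels) : Prop :=
  [/\ kept 6 X Y, forall ds, Y (6 :: ds) -> tuple4 reach ds &
    blacks <= n -> whites <= n -> forall B W, separates B W ->
      #|B| + #|W| <= t -> exists a c, [/\ last_of a B, last_of c W &
        Y [:: 6; a; c; blacks - #|B|; whites - #|W|]]].

Lemma color_step_ok X Y t : t <= n ->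
  (forall u v, u <= n -> v <= n -> X [:: 4; u; v; 0;
    0] <-> may_follow n cell u v) ->
  (forall u v, u <= n -> v <= n -> X [:: 5; u; v; 0; 0] <-> separated n cell u v) ->
  explored X t Y -> explored X t.+1 (sem color_step (rcons rho0 t) Y).
Proof.
move=> tn XF XS [fr so cp].
pose I Z := extends 6 X (tuple4 reach) Z /\ forall k, Y k -> Z k.
pose Q v a c x y Z := Y [:: 6; a; c; x; y] ->
  may_follow n cell a v -> may_follow n cell c v ->
  (separated n cell c v -> Z [:: 6; v; c; x.-1; y]) /\
  (separated n cell a v -> Z [:: 6; a; v; x; y.-1]).
have upQ v a c x y : incr (Q v a c x y).
  move=> ? ? YZ H ? ? ?; have [//|//|//|H1 H2] := H.
  by split=> ?; apply: YZ; [apply: H1|apply: H2].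
have S : spec n cell I color_step (rcons rho0 t) (fun Z =>
    forall v, v <= n -> forall a, a <= n -> forall c, c <= n ->
    forall x, x <= n -> forall y, y <= n -> Q v a c x y Z).
  apply: spec_For => [v|v vn]; first by do 4!apply: incr_all => ?.
  apply: spec_For => [a|a an]; first by do 3!apply: incr_all => ?.
  apply: spec_For => [c|c cn]; first by do 2!apply: incr_all => ?.
  apply: spec_For => [x|x xn]; first by apply: incr_all.
  apply: spec_For => [//|y yn] Z [IZ YZ]; have [frZ soZ] := IZ.
  rewrite !semIf semSeq /= !eqb_id /key /= !(frZ 4) //.
  case: ifP => [Zk|nZ]; last by split=> // /YZ; rewrite nZ.
  case: ifP => [/XF av|nav]; last by split=> // _ /(XF _ _ an vn).2; rewrite nav.
  case: ifP => [/XF cv|ncv]; last by split=> // _ _ /(XF _ _ cn vn).2; rewrite ncv.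
  have rk : reach a c x y := soZ _ Zk.
  have {}av := av an vn; have {}cv := cv cn vn.
  set Z1 := sem _ _ Z.
  have [IZ1 ZZ1 Z1k] : [/\ extends 6 X (tuple4 reach) Z1, forall k, Z k -> Z1 k &
      separated n cell c v -> Z1 [:: 6; v; c; x.-1; y]].
    rewrite /Z1 semIf semPred /= eqb_id /key /= frZ //.
    case: ifP => [/XS scv|ns]; last by split=> // /(XS _ _ cn vn).2; rewrite ns.
    split; [|by move=> k; apply: sem_incr|by rewrite semPut eqxx].
    by apply: extends_put => //=; apply: reach_black av cv (scv cn vn).
  have [frZ1 _] := IZ1.
  rewrite semIf semPred /= eqb_id /key /= frZ1 //.
  case: ifP => [/XS sav|ns]; last first.
    split; first by split=> // k /YZ/ZZ1.
    by move=> _ _ _; split=> [/Z1k//|/(XS _ _ an vn).2]; rewrite ns.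
  split; last first.
    move=> _ _ _; split=> [/Z1k|_]; first exact: sem_incr.
    by rewrite semPut eqxx.
  split; last by move=> k /YZ/ZZ1; apply: sem_incr.
  by apply: extends_put => //=; apply: reach_white rk av cv (sav an vn).
have [|[[frZ soZ] YZ] q] := S Y; first by [].
set Z := sem _ _ _ in frZ soZ YZ q *.
split=> // bn wn B W s.
rewrite leq_eqVlt => /orP[/eqP cBW|]; last first.
  by rewrite ltnS => /(cp bn wn B W s)[a [c [la lc /YZ Zac]]]; exists a, c.
have [e|[v0 v0U]] := finset.set_0Vmem (B :|: W).
  move/eqP: e; rewrite finset.setU_eq0 => /andP[/eqP eB /eqP eW].
  by move: cBW; rewrite eB eW !finset.cards0.
(* Without its last vertex the coloring is covered by the previous rounds, and the present round
   adds that vertex back. *)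
have [v /finset.setUP[vB|vW] vmax] := ex_last v0U.
- have cB : #|B| = #|B :\ v|.+1 by rewrite (cardsD1 v B) vB.
  have s' : separates (B :\ v) W.
    by move=> x y /finset.setD1P[_ xB]; apply: s.
  have [|a [c [la lc Yac]]] := cp bn wn _ _ s'; first by lia.
  have [av cv scv lv] := remove_last s vB vmax la lc.
  have vn : v <= n := ltnW (ltn_ord v).
  have [] := q v vn a (last_of_le la) c (last_of_le lc) _ _ _ _ Yac av cv; try lia.
  by move=> /(_ scv) Zk _; exists v, c; split=> //; rewrite cB subnS.
- have cW : #|W| = #|W :\ v|.+1 by rewrite (cardsD1 v W) vW.
  have s' : separates B (W :\ v).
    by move=> x y xB /finset.setD1P[_ yW]; apply: s.
  have [|a [c [la lc Yac]]] := cp bn wn _ _ s'; first by lia.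
  rewrite finset.setUC in vmax.
  have [cv av sav lv] := remove_last (separates_sym s) vW vmax lc la.
  have vn : v <= n := ltnW (ltn_ord v).
  have [] := q v vn a (last_of_le la) c (last_of_le lc) _ _ _ _ Yac av cv; try lia.
  by move=> _ /(_ sav) Zk; exists a, v; split=> //; rewrite cW subnS.
Qed.

Lemma coloring_ok X0 X :
  kept 6 X0 X ->
  (forall u v, u <= n -> v <= n -> X0 [:: 4; u; v; 0;
    0] <-> may_follow n cell u v) ->
  (forall u v, u <= n -> v <= n -> X0 [:: 5; u; v; 0;
    0] <-> separated n cell u v) ->
  (forall ds, X (6 :: ds) -> ds = [:: n; n; blacks; whites]) ->
  (blacks <= n -> whites <= n -> X [:: 6; n; n; blacks; whites]) ->
  explored X0 n.+1 (sem coloring rho0 X).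
Proof.
move=> kX XF XS so cp.
apply: (For_inv (I := explored X0)) => [t Y tn|]; first exact: color_step_ok.
have n0 U : #|U| = 0 -> last_of n U.
  by move=> U0; left; split=> // u; rewrite (card0_eq U0).
split=> // [ds /so ->|bn wn B W s].
  exists finset.set0, finset.set0; rewrite finset.cards0 !subn0; split=> //.
  - by move=> x y; rewrite finset.inE.
  - by apply: n0; rewrite finset.cards0.
  - by apply: n0; rewrite finset.cards0.
rewrite leqn0 addn_eq0 => /andP[/eqP B0 /eqP W0]; exists n, n.
by split; [exact: n0|exact: n0|rewrite B0 W0 !subn0; apply: cp].
Qed.

Lemma answer_ok X : empty_rel 7 X ->
  sem answer rho0 X [:: 7; 0; 0; 0; 0] <->
  exists a c, [/\ a <= n, c <= n & X [:: 6; a; c; 0; 0]].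
Proof.
move=> e7.
pose I := extends 7 X (fun _ => exists a c, [/\ a <= n, c <= n & X [:: 6; a; c;
  0; 0]]).
pose Q a c Y := X [:: 6; a; c; 0; 0] -> Y [:: 7; 0; 0; 0; 0] : Prop.
have upQ a c : incr (Q a c) by move=> ? ? YZ H ?; apply/YZ/H.
have S : spec n cell I answer rho0 (fun Y => forall a, a <= n ->
    forall c, c <= n -> Q a c Y).
  apply: spec_For => [a|a an]; first by apply: incr_all.
  apply: spec_For => [//|c cn] Y IY; have [fr _] := IY.
  rewrite !semIf /= eqb_id /key /= fr //.
  case: ifP => [Xk|nX]; last by split=> //; rewrite /Q nX.
  split; last by move=> _; rewrite semPut eqxx.
  by apply: extends_put => //; exists a, c.
have [|[fr so] q] := S X; first exact: extends_empty.
split=> [/so //|[a [c [an cn Xk]]]]; exact: q Xk.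
Qed.

End Coloring.

(** * Composition of the phases *)

Section Main.
Variables (n blacks whites : nat) (cell : nat -> nat).
Notation h := (nonadj n cell).
Hypothesis h_sym : symmetric h.
Hypothesis no_flip : forall u v, ~ forced h u v v u.
Hypothesis no_C4 : forall a b c d, h a b -> h c d ->
  [|| h a c, h c b, h b d | h d a].

Lemma main_ok :
  sem n cell main (base n blacks whites) (fun=> false) [:: 7; 0; 0; 0; 0] <->
  exists B W : {set 'I_n},
    [/\ separates cell B W, blacks <= #|B| & whites <= #|W|].
Proof.
pose fresh t X := forall t', t <= t' -> empty_rel t' X.
have step t X Y : kept t X Y -> fresh t X -> fresh t.+1 Y.
  by move=> k f t' tt' ds; rewrite k ?f //; [exact: ltnW|rewrite gtn_eqF].
rewrite /main /= !semSeq.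
have f0 : fresh 0 (fun=> false) by [].
have [k1 H1] := @nonadjacency_ok n blacks whites cell h_sym _ (f0 0 isT).
move: (sem _ _ _ _ _) k1 H1 => X1 /step/(_ f0) f1 H1.
have [k2 so2 g2] := @forcing_ok n blacks whites cell h_sym _ (f1 1 isT) H1.
move: (sem _ _ _ _ X1) k2 so2 g2 => X2 k2 so2 g2.
have H2 u v : u <= n -> v <= n -> X2 [:: 0; u; v; 0;
  0] = h u v by move=> un vn; rewrite k2 ?H1.
have {k2}f2 := step _ _ _ k2 f1.
have [k3 T3] := @closure_ok n blacks whites cell h_sym _ so2 g2.
move: (sem _ _ _ _ X2) k3 T3 => X3 k3 T3.
have H3 u v : u <= n -> v <= n -> X3 [:: 0; u; v; 0;
  0] = h u v by move=> un vn; rewrite k3 ?H2.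
(* Relation 1 is already filled when the closure enlarges it, so [step] does not apply. *)
have f3 : fresh 2 X3.
  by move=> t' t2 ds; rewrite k3 ?f2 //; move: t2; case: t' => [|[]].
have [k4 O4 tot] := @orient_ok n blacks whites cell h_sym no_flip _ (f3 2 isT) T3.
move: (sem _ _ _ _ X3) k4 O4 => X4 k4 O4.
have H4 u v : u <= n -> v <= n -> X4 [:: 0; u; v; 0;
  0] = h u v by move=> un vn; rewrite k4 ?H3.
have f4 := step _ _ _ k4 f3.
have [k5 L5] := @not_le_ok n blacks whites cell _ (f4 3 isT) O4.
move: (sem _ _ _ _ X4) k5 L5 => X5 k5 L5.
have H5 u v : u <= n -> v <= n -> X5 [:: 0; u; v; 0;
  0] = h u v by move=> un vn; rewrite k5 ?H4.
have f5 := step _ _ _ k5 f4.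
have [k6 P6] := @precedence_ok n blacks whites cell _ (f5 4 isT) L5.
move: (sem _ _ _ _ X5) k6 P6 => X6 k6 P6.
have H6 u v : u <= n -> v <= n -> X6 [:: 0; u; v; 0;
  0] = h u v by move=> un vn; rewrite k6 ?H5.
have f6 := step _ _ _ k6 f5.
have [k7 Q7] := @separation_ok n blacks whites cell _ (f6 5 isT) H6.
move: (sem _ _ _ _ X6) k7 Q7 => X7 k7 Q7.
have P7 u v : u <= n -> v <= n -> X7 [:: 4; u; v; 0; 0] <-> may_follow n cell u v.
  by move=> un vn; rewrite k7 //; apply: P6.
have f7 := step _ _ _ k7 f6.
have [k8 so8 cp8] := @start_ok n blacks whites cell _ (f7 6 isT).
move: (sem _ _ _ _ X7) k8 so8 cp8 => X8 k8 so8 cp8.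
have f8 := step _ _ _ k8 f7.
have [k9 so9 cp9] := @coloring_ok n blacks whites cell h_sym tot no_C4 _ _ k8
  P7 Q7 so8 cp8.
move: (sem _ _ _ _ X8) k9 so9 cp9 => X9 k9 so9 cp9.
have e9 : empty_rel 7 X9 by move=> ds; rewrite k9 // f7.
rewrite answer_ok //; split=> [[a [c [an cn /so9]]]|[B [W [s bB wW]]]].
  move=> [B [W [s _ _ x0 y0]]]; exists B, W; split=> //.
    by rewrite -subn_eq0 -x0.
  by rewrite -subn_eq0 -y0.
have bn : blacks <= n by apply: leq_trans bB _; rewrite -[leqRHS]card_ord max_card.
have wn : whites <= n by apply: leq_trans wW _; rewrite -[leqRHS]card_ord max_card.
have BW : #|B| + #|W| <= n.+1.
  have BW0 : B :&: W = finset.set0.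
    apply/finset.setP => x; rewrite !finset.inE.
    by apply/negP => /andP[xB xW]; have := s x x xB xW; rewrite nonadj_irr.
  rewrite -finset.cardsUI BW0 finset.cards0 addn0 ltnW // ltnS -[leqRHS]card_ord.
  exact: max_card.
have [a [c [la lc Xac]]] := cp9 bn wn B W s BW.
exists a, c; split; [exact: last_of_le la|exact: last_of_le lc|].
by move: Xac; rewrite (eqP bB) (eqP wW).
Qed.

End Main.


(** * Interval graphs *)

Section Interval.
Local Open Scope ring_scope.
Import Order.TTheory.
Variable R : realType.
Implicit Types i j : interval R.

Lemma interval_convex i x y z : x \in i -> z \in i -> x <= y -> y <= z -> y \in i.
Proof.
case: i => l u; rewrite !itv_boundlr => /andP[lx _] /andP[_ zu] xy yz.
by rewrite (le_trans lx) ?bnd_simp //= (le_trans _ zu) ?bnd_simp.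
Qed.

(** By convexity a reversed comparison would put [y] or [x'] into both intervals. *)
Lemma disjoint_lt i j x y x' y' : (forall z, z \in i -> z \in j -> False) ->
  x \in i -> x' \in i -> y \in j -> y' \in j -> x < y -> x' < y'.
Proof.
move=> dis xi x'i yj y'j xy; rewrite ltNge; apply/negP => y'x'.
have [yx'|x'y] := leP y x'.
  by apply: (dis y) => //; apply: interval_convex xi x'i (ltW xy) yx'.
by apply: (dis x') => //; apply: interval_convex y'j yj y'x' (ltW x'y).
Qed.

End Interval.

Section IntervalGraph.
Variables (R : realType) (n : nat) (G : sgraph 'I_n) (I : 'I_n -> interval R).
Hypothesis adjI : forall u v, u != v ->
  (adj G u v <-> ([set` I u] `&` [set` I v] !=set0)%classic).
Notation h := (nonadj n (adj_cell G)).

Lemma adj_cellE (u v : 'I_n) : adj_cell G (u * n + v) = adj G u v.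
Proof.
have n0 : 0 < n by case: (n) u => [[]|].
rewrite /adj_cell divnMDl // modnMDl divn_small // modn_small // addn0.
by rewrite !valK.
Qed.

Lemma nonadj_ordE (u v : 'I_n) : h u v = (u != v) && ~~ adj G u v.
Proof. by rewrite /nonadj !ltn_ord adj_cellE eqb0. Qed.

Lemma nonadj_ord u v : h u v -> exists u' v' : 'I_n, u = u' /\ v = v'.
Proof. by move=> /nonadj_lt[un vn]; exists (Ordinal un), (Ordinal vn). Qed.

Lemma nonadj_sym : symmetric h.
Proof.
suff H u v : h u v -> h v u by move=> u v; apply/idP/idP; apply: H.
move=> huv; have [u' [v' [eu ev]]] := nonadj_ord huv.
by move: huv; rewrite eu ev !nonadj_ordE eq_sym adj_sym.
Qed.

Lemma nonadj_disjoint (u v : 'I_n) : h u v ->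
  forall z, z \in I u -> z \in I v -> False.
Proof.
rewrite nonadj_ordE => /andP[uv nuv] z zu zv; move/negP: nuv; apply.
by apply/(adjI uv); exists z.
Qed.

Lemma not_nonadj_meet (u v : 'I_n) : ~~ h u v -> u != v ->
  exists2 z, z \in I u & z \in I v.
Proof.
rewrite nonadj_ordE => nuv uv; move: nuv; rewrite uv negbK => /(adjI uv).
by case=> z [zu zv]; exists z.
Qed.

(* The left-to-right order of the intervals, empty intervals being put first
   and ordered by index. *)
Definition left_of (u v : 'I_n) : Prop :=
  (exists x y, [/\ x \in I u, y \in I v & (x < y)%R]) \/
  (forall x, x \notin I u) /\ ((exists y, y \in I v) \/ u < v).

Lemma left_of_total (u v : 'I_n) : h u v -> left_of u v \/ left_of v u.
Proof.
move=> huv; have dis := nonadj_disjoint huv.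
have neq : u != v by move: huv; rewrite nonadj_ordE => /andP[].
have [[x xu]|/forallNP eu] := pselect (exists x, x \in I u);
  have [[y yv]|/forallNP ev] := pselect (exists y, y \in I v).
- case: (Order.TotalTheory.ltgtP x y) => xy.
  + by left; left; exists x, y.
  + by right; left; exists y, x.
  + by case: (dis x); rewrite // xy.
- by right; right; split=> [z|]; [apply/negP/ev|left; exists x].
- by left; right; split=> [z|]; [apply/negP/eu|left; exists y].
- case: (ltngtP u v) => uv.
  + by left; right; split=> [z|]; [apply/negP/eu|right].
  + by right; right; split=> [z|]; [apply/negP/ev|right].
  + by move/eqP: neq => []; apply: val_inj.
Qed.

Lemma left_of_asym (u v : 'I_n) : h u v -> left_of u v -> ~ left_of v u.
Proof.
move=> huv; have dis := nonadj_disjoint huv.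
case=> [[x [y [xu yv xy]]]|[eu ev]].
  case=> [[y' [x' [yv' xu' yx]]]|[ev _]]; last by have := ev y; rewrite yv.
  have := disjoint_lt dis xu xu' yv yv' xy.
  by move/(Order.POrderTheory.lt_trans yx); rewrite Order.POrderTheory.ltxx.
case=> [[_ [x [_ xu _]]]|[ev' eu']]; first by have := eu x; rewrite xu.
case: ev => [[y yv]|uv]; first by have := ev' y; rewrite yv.
case: eu' => [[x xu]|vu]; first by have := eu x; rewrite xu.
by have := ltn_trans uv vu; rewrite ltnn.
Qed.

Lemma left_of_head (u v v' : 'I_n) : h u v -> h u v' -> ~~ h v v' ->
  left_of u v -> left_of u v'.
Proof.
move=> huv huv' nvv'; have [<-//|vv'] := eqVneq v v'.
have [z zv zv'] := not_nonadj_meet nvv' vv'.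
case=> [[x [y [xu yv xy]]]|[eu _]]; last by right; split=> //; left; exists z.
left; exists x, z; split=> //.
exact: (disjoint_lt (nonadj_disjoint huv) xu xu yv zv xy).
Qed.

Lemma left_of_tail (u u' v : 'I_n) : h u v -> h u' v -> ~~ h u u' ->
  left_of u v -> left_of u' v.
Proof.
move=> huv huv' nuu'; have [<-//|uu'] := eqVneq u u'.
have [z zu zu'] := not_nonadj_meet nuu' uu'.
case=> [[x [y [xu yv xy]]]|[eu _]]; last by have := eu z; rewrite zu.
left; exists z, y; split=> //.
exact: (disjoint_lt (nonadj_disjoint huv) xu zu yv yv xy).
Qed.

Lemma forced_left_of a b c d : forced h a b c d ->
  forall a' b' c' d' : 'I_n, a = a' -> b = b' -> c = c' -> d = d' ->
  left_of a' b' -> left_of c' d'.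
Proof.
move=> F a' b' + + ea eb; elim: F => {c d}
  [_|c d d1 F IH h1 h2|c c1 d F IH h1 h2] c' d' ec ed l.
- have -> : c' = a' by apply: val_inj; rewrite /= -ec -ea.
  by have -> : d' = b' by apply: val_inj; rewrite /= -ed -eb.
- have [_ hcd] := forced_h F.
  have [_ [d2 [_ ed2]]] := nonadj_ord hcd.
  have := IH c' d2 ec ed2 l; apply: left_of_head; rewrite -?ec -?ed -?ed2 //.
- have [_ hcd] := forced_h F.
  have [c2 [_ [ec2 _]]] := nonadj_ord hcd.
  have := IH c2 d' ec2 ed l; apply: left_of_tail; rewrite -?ec -?ed -?ec2 //.
Qed.

(** [left_of] directs each pair of [h] in exactly one way and is preserved by forcing, so a class
    containing an arc and its reversal would contradict asymmetry. *)
Lemma forced_no_flip u v : ~ forced h u v v u.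
Proof.
move=> F; have [huv _] := forced_h F; have [u' [v' [eu ev]]] := nonadj_ord huv.
have F' := forced_flip nonadj_sym F.
have huv' : h u' v' by rewrite -eu -ev.
case: (left_of_total huv') => l.
  by apply: (left_of_asym huv' l); apply: (forced_left_of F eu ev ev eu l).
by apply: (left_of_asym huv' _ l); apply: (forced_left_of F' ev eu eu ev l).
Qed.

Lemma nonadj_no_C4 a b c d : h a b -> h c d ->
  [|| h a c, h c b, h b d | h d a].
Proof.
move=> hab hcd; apply/negPn; rewrite !negb_or;
  apply/negP => /and4P[nac ncb nbd nda].
have [a' [b' [ea eb]]] := nonadj_ord hab; have [c' [d' [ec ed]]] := nonadj_ord hcd.
have hsym := nonadj_sym.
rewrite {}ea {}eb in hab nac ncb nbd nda; rewrite {}ec {}ed in hcd nac ncb nbd nda.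
have ac : a' != c' by apply: contraNneq nda => ->; rewrite hsym.
have cb : c' != b' by apply: contraNneq nac => ->.
have bd : b' != d' by apply: contraNneq ncb => ->.
have da : d' != a' by apply: contraNneq nbd => ->; rewrite hsym.
have [p pa pc] := not_nonadj_meet nac ac; have [q qc qb] := not_nonadj_meet ncb cb.
have [r rb rd] := not_nonadj_meet nbd bd; have [s sd sa] := not_nonadj_meet nda da.
have dab := nonadj_disjoint hab; have dcd := nonadj_disjoint hcd.
(* Exchanging a' and b' swaps p with q and r with s; p = q would be a common point of two disjoint
   intervals. *)
wlog pq : a' b' {hab nac ncb nbd nda ac cb bd da} p q r s
  pa pc qc qb rb rd sd sa dab / (p < q)%R => [W|].
  case: (Order.TotalTheory.ltgtP p q) => pq.
  - exact: (W a' b' p q r s).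
  - by apply: (W b' a' q p s r) => // z zb za; apply: dab za zb.
  - by apply: (dab p); rewrite // pq.
have lt := disjoint_lt dab.
have := lt _ _ p r pa pa qb rb pq; have := lt _ _ s q pa sa qb qb pq.
have := lt _ _ s r pa sa qb rb pq.
move=> sr sq pr.
(* All of a' now lies left of b'. Either s is between p and q, hence in c', or p is between s and r,
   hence in d'; both contradict disjointness of c' and d'. *)
have [ps|sp] := Order.TotalTheory.leP p s.
  apply: (dcd s) => //; apply: interval_convex pc qc ps _.
  exact: Order.POrderTheory.ltW.
apply: (dcd p) => //; apply: interval_convex sd rd _ _;
  exact: Order.POrderTheory.ltW.
Qed.

Lemma separates_adj (B W : {set 'I_n}) : separates (adj_cell G) B W <->
  [disjoint B & W] /\ forall x y, x \in B -> y \in W -> ~~ adj G x y.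
Proof.
split=> [s|[dBW s] x y xB yW].
  split; last by move=> x y xB yW; have := s x y xB yW;
    rewrite nonadj_ordE => /andP[].
  apply/pred0P => x /=; apply/negP => /andP[xB xW].
  by have := s x x xB xW; rewrite nonadj_irr.
rewrite nonadj_ordE s // andbT; apply: contraTneq yW => <-.
by rewrite (disjointFr dBW).
Qed.

End IntervalGraph.

(** * Exact color counts and the decision program *)

Lemma subset_of_card (T : finType) (A : {set T}) k : k <= #|A| ->
  exists2 B : {set T}, B \subset A & #|B| = k.
Proof.
move=> /card_geqP[s [us <- sA]]; exists [set x in s]%SET.
  by apply/fintype.subsetP => x; rewrite finset.inE => /sA.
by rewrite cardsE; apply/card_uniqP.
Qed.

(** The program detects color classes of at least the demanded sizes; subsets of such classes remain
    valid, so exact sizes follow. *)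
Lemma bw_colorableP (R : realType) n (G : sgraph 'I_n) b w :
  interval_graph R G ->
  sem n (adj_cell G) main (base n b w) (fun=> false) [:: 7; 0; 0; 0; 0] <->
  bw_colorable G b w.
Proof.
case=> I adjI; rewrite main_ok; first last.
- exact: nonadj_no_C4 adjI.
- exact: forced_no_flip adjI.
- exact: nonadj_sym.
split=> [[B [W [/separates_adj[dBW s] /subset_of_card[B' BB' <-]
  /subset_of_card[W' WW' <-]]]]|].
  exists B', W'; split=> //; first exact: disjointW BB' WW' dBW.
  by move=> x y xB yW; apply: s;
    [apply: (fintype.subsetP BB')|apply: (fintype.subsetP WW')].
move=> [B [W [dBW <- <- s]]]; exists B, W; split=> //.
exact/separates_adj.
Qed.

Lemma adj_cell_le1 n (G : sgraph 'I_n) a : adj_cell G a <= 1.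
Proof. by rewrite /adj_cell; do 2?case: insub => // ?; case: (adj G _ _). Qed.

Lemma adj_cell0 n (G : sgraph 'I_n) a : n * n <= a -> adj_cell G a = 0.
Proof.
move=> na; rewrite /adj_cell insubF //; apply/negbTE; rewrite -leqNgt.
by case: n G na => // n _ na; rewrite leq_divRL.
Qed.

(** The first two instructions complete the environment [base]; register 3 is 0 in the input. *)
Definition decider (c : cmd) : program :=
  let s := compile 6 2 c in
  let t := cond_code 6 (In 7 [:: 3; 3; 3; 3]) in
  Const 4 1 :: Plus 5 0 4 :: s ++ t ++
  [:: JumpEq 6 3 (2 + size s + size t).+2; Halt true; Halt false].

Lemma decider_runs n (G : sgraph 'I_n) b w c : wf 6 c ->
  runs (word_bound 8 n b w) (decider c) (cost n.+1 c + 16) (bw_input G b w)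
    (Halted (sem n (adj_cell G) c (base n b w) (fun=> false) [:: 7; 0; 0; 0; 0])).
Proof.
move=> wfc; set a := sem _ _ _ _ _ _.
have wide : wide_enough (word_bound 8 n b w) n b w by apply: leqnn.
set M := word_bound _ _ _ _ in wide *; set P := decider c.
set rho := base n b w; set m0 := adj_cell G.
pose r0 := nth 0 [:: n; b; w]; pose r := upd (upd r0 4 1) 5 n.+1.
have ag : agree rho r by case=> [|[|[|[|[|[|]]]]]].
have g : good n b w rho by exists [::]; rewrite ?cats0.
have mX : represents n m0 m0 (fun=> false).
  split=> // [|t ds _ _]; first exact: adj_cell_le1.
  rewrite /m0 adj_cell0 // /addr; apply: leq_trans (leq_addl _ _).
  by apply: leq_mul.
have /code_at_cons [e1 /code_at_cons [e2 /code_at_cat [cm /code_at_cat [cc]]]] :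
  code_at P 0 P by exists [::], [::]; split=> //; rewrite cats0.
have [r1 [m1 [ag1 mX1 ru1]]] := compile_correct wide g ag mX wfc cm.
have [r2 [ag2 r2a ru2]] := @cond_code_runs _ P _ _ _ m0 wide _ _ _ _ _ (In 7
  [:: 3; 3; 3; 3]) g ag1 mX1 isT cc.
set l := 2 + _ + _ in ru2 *.
move=> /code_at_cons [e3 /code_at_cons [e4 /code_at_cons [e5 _]]].
(* Two steps set up the registers, twelve test the answer tuple, two jump and halt. *)
rewrite (_ : _ + 16 = 2 + (cost n.+1 c + (12 + 2))); last by lia.
apply: (@runs_trans _ _ _ _ _ (Running 2 r m0)).
  apply/runsS; rewrite /step /bw_input e1 ifT; last by apply: (small_lt_M wide).
  apply/runsS; rewrite /step e2 ifT; first by rewrite /= addn1; apply: runs0.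
  by rewrite /= addn1; apply: (small_lt_M wide).
apply: (runs_trans ru1); apply: (runs_trans ru2).
have z : r2 3 = 0 by rewrite (agree_base g ag2).
have {}r2a : (r2 6 != 0) = a by [].
apply/runsS; rewrite /step e3 z -r2a; case: eqP => _.
  by apply/runsS; rewrite /step e5; apply: runs0.
by apply/runsS; rewrite /step e4; apply: runs0.
Qed.

Theorem theorem7 :
  exists (P : program) (k : nat) (T : nat -> nat),
    bigO T (fun n => n ^ 6) /\
    forall (R : realType) (n : nat) (G : sgraph 'I_n) (b w : nat),
      interval_graph R G ->
      exists a : bool,
        run (word_bound k n b w) P (T n) (bw_input G b w) = Halted a /\
        (a <-> bw_colorable G b w).
Proof.
exists (decider main), 8, (fun n => cost n.+1 main + 16); split.
  (* For positive [n], n + 1 <= 2 * n accounts for the factor 2 ^ 6; the additive 16 is absorbed by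
     (n + 1) ^ 6 >= 1. *)
  exists ((16 + weight main) * 2 ^ 6), 1 => n n0.
  have := @cost_le n.+1 main isT; rewrite main_depth.
  have : n.+1 ^ 6 <= 2 ^ 6 * n ^ 6 by rewrite -expnMn leq_exp2r //; lia.
  have : 0 < n.+1 ^ 6 by rewrite expn_gt0.
  move: (cost _ _) (weight _) (n.+1 ^ 6) (n ^ 6) (2 ^ 6) => c k x y z x0 xz cx.
  apply: (@leq_trans ((16 + k) * x)); first by rewrite mulnDl; lia.
  by rewrite -mulnA leq_mul2l xz orbT.
move=> R n G b w IG; exists (sem n (adj_cell G) main (base n b w) (fun=> false)
  [:: 7; 0; 0; 0; 0]).
split; last exact: bw_colorableP IG.
have [t tT rt] := decider_runs G b w main_wf.
(* A halted configuration is stationary, so the surplus steps up to the bound change nothing. *)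
rewrite -(subnK tT) /run iterD -/(run _ _ t _) rt.
by elim: (_ - t) => //= m ->.
Qed.
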